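(* Let $0<q<1$ and let $p$ be a prime. For each $n$ let $\Gamma\in G(n,q)$ be an Erdős–Rényi random graph with sandpile group $S$, and let $H_n$ be a uniform random $n\times n$ symmetric matrix with entries in $\mathbb{Z}/p\mathbb{Z}$. Then for every non-negative integer $r$, $$\lim_{n\to\infty}\mathbb{P}(\operatorname{rank}(S\otimes\mathbb{Z}/p\mathbb{Z})=r)=\lim_{n\to\infty}\mathbb{P}(\operatorname{rank}(H_n)=n-r)=p^{-\frac{r(r+1)}{2}}\prod_{i=r+1}^\infty(1-p^{-i})\prod_{i=1}^\infty(1-p^{-2i})^{-1}.$$
   Context: $G(n,q)$: random graph on the labeled vertex set $[n]=\{1,\dots,n\}$ in which each of the $\binom n2$ possible edges is present independently with probability $q$. Sandpile group: for a graph $\Gamma$ on $[n]$, the Laplacian $L_\Gamma$ is the $n\times n$ integer matrix with $(i,j)$ entry $1$ if $i\neq j$ and $\{i,j\}$ is an edge, $0$ if $i\ne j$ and $\{i,j\}$ is not an edge, and $-\deg(i)$ if $i=j$. Let $Z\subset\mathbb{Z}^n$ be the subgroup of vectors whose coordinates sum to $0$. The column space of $L_\Gamma$ is contained in $Z$, and the sandpile group of $\Gamma$ is $Z/L_\Gamma\mathbb{Z}^n$, a finitely generated abelian group. $\operatorname{rank}(S\otimes\mathbb{Z}/p\mathbb{Z})$ is the dimension of $S\otimes_{\mathbb{Z}}\mathbb{Z}/p\mathbb{Z}$ over $\mathbb{Z}/p\mathbb{Z}$. *)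

(* Defs.v *)
From HB Require Import structures.
From mathcomp Require Import all_boot all_order all_algebra.
From mathcomp Require Import generic_quotient ring_quotient.
From mathcomp Require Import freeg.
From mathcomp Require Import boolp classical_sets reals topology normedtype.

Set Implicit Arguments.
Unset Strict Implicit.
Unset Printing Implicit Defensive.

Import GRing.Theory numFieldNormedType.Exports.

Local Open Scope ring_scope.
Local Open Scope quotient_scope.

(* A simple graph on 'I_n is its edge set, a set of 2-element subsets. *)
Definition pairs (n : nat) : {set {set 'I_n}} := [set e : {set 'I_n} | #|e| == 2].

Definition adj (n : nat) (g : {set {set 'I_n}}) (i j : 'I_n) : bool :=
  (i != j) && ([set i; j]%SET \in g).

Definition gdeg (n : nat) (g : {set {set 'I_n}}) (i : 'I_n) : nat :=
  #|[set j | adj g i j]|.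

Definition gnq_weight (R : realType) (n : nat) (q : R)
    (g : {set {set 'I_n}}) : R :=
  \prod_(e in pairs n) (if e \in g then q else 1 - q).

(* The probability of E in G(n,q), whose sample space is powerset (pairs n). *)
Definition gnq_prob (R : realType) (n : nat) (q : R)
    (E : {set {set 'I_n}} -> Prop) : R :=
  \sum_(g in powerset (pairs n) | `[< E g >]) gnq_weight q g.

Definition laplacian (n : nat) (g : {set {set 'I_n}}) : 'M[int]_n :=
  \matrix_(i, j) if i == j then - (gdeg g i)%:Z else (adj g i j : nat)%:Z.

Section Sum0.
Variable n : nat.

Definition sum0 : {pred 'cV[int]_n} := [pred v : 'cV[int]_n | \sum_i v i 0 == 0].

Fact sum0_zmod_closed : zmod_closed sum0.
Proof.
split=> [|u v]; first by rewrite inE big1 // => i _; rewrite mxE.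
rewrite !inE => /eqP u0 /eqP v0.
under eq_bigr do rewrite !mxE.
by rewrite sumrB u0 v0 subrr.
Qed.

HB.instance Definition _ := GRing.isZmodClosed.Build _ sum0 sum0_zmod_closed.

Record sum0_lattice := Sum0 { sum0_val :> 'cV[int]_n ; _ : sum0_val \in sum0 }.

HB.instance Definition _ := [isSub for sum0_val].
HB.instance Definition _ := [Choice of sum0_lattice by <:].
HB.instance Definition _ := [SubChoice_isSubZmodule of sum0_lattice by <:].
End Sum0.

Fact laplacian_sum0 (n : nat) (g : {set {set 'I_n}}) (x : 'cV[int]_n) :
  laplacian g *m x \in @sum0 n.
Proof.
have adjC i j : adj g i j = adj g j i by rewrite /adj eq_sym finset.setUC.
rewrite inE; under eq_bigr do rewrite mxE.
rewrite exchange_big big1 //= => j _; rewrite -mulr_suml.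
rewrite (_ : \sum_i _ = 0) ?mul0r // (bigD1 j) //= mxE eqxx addrC.
apply/eqP; rewrite subr_eq0 /gdeg -sum1_card raddf_sum /=.
rewrite big_mkcond [eqbRHS]big_mkcond; apply/eqP; apply: eq_bigr => i _.
rewrite !mxE finset.in_set adjC; have [->|ij] := eqVneq i j.
  by rewrite /adj eqxx.
by case: (adj g j i).
Qed.

Section Sandpile.
Variables (n : nat) (g : {set {set 'I_n}}).

(* By laplacian_sum0 this is all of L Z^n, seen inside the lattice. *)
Definition laplacian_image : {pred sum0_lattice n} :=
  [pred v : sum0_lattice n | `[< exists x : 'cV[int]_n, sum0_val v = laplacian g *m x >]].

Fact laplacian_image_zmod_closed : zmod_closed laplacian_image.
Proof.
split=> [|u v]; rewrite /in_mem /=; first by apply/asboolP; exists 0; rewrite mulmx0.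
move=> /asboolP[x ux] /asboolP[y vy]; apply/asboolP; exists (x - y).
by rewrite mulmxBr -ux -vy.
Qed.

HB.instance Definition _ :=
  GRing.isZmodClosed.Build _ laplacian_image laplacian_image_zmod_closed.

Definition sandpile : zmodType := Quotient.quot laplacian_image.
End Sandpile.

Section Tensor.
Variables (S : zmodType) (A : pzRingType).

Local Notation free := {freeg (S * A)%type / int}.
Local Notation gen s a := (<< (s : S, a : A) >> : free).

(* The subgroup of the free abelian group on S * A generated by the relations
   of biadditivity; the quotient by it is the tensor product of S and A over
   the integers. *)
Inductive tensor_rel : free -> Prop :=
| TensorRel0 : tensor_rel 0
| TensorRelB x y : tensor_rel x -> tensor_rel y -> tensor_rel (x - y)
| TensorRelDl s t a : tensor_rel (gen (s + t) a - (gen s a + gen t a))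
| TensorRelDr s a b : tensor_rel (gen s (a + b) - (gen s a + gen s b)).

Definition tensor_rels : {pred free} := [pred x : free | `[< tensor_rel x >]].

Fact tensor_rels_zmod_closed : zmod_closed tensor_rels.
Proof.
split=> [|x y]; rewrite /in_mem /=; first by apply/asboolP; exact: TensorRel0.
by move=> /asboolP rx /asboolP ry; apply/asboolP; exact: TensorRelB.
Qed.

HB.instance Definition _ :=
  GRing.isZmodClosed.Build _ tensor_rels tensor_rels_zmod_closed.

Definition tensor := Quotient.quot tensor_rels.
HB.instance Definition _ := GRing.Zmodule.on tensor.

Definition tens (s : S) (a : A) : tensor := \pi_tensor (gen s a).

(* The action of A on the tensor product is c *: tens s a = tens s (c * a); it
   is first defined on the free abelian group. *)
Definition free_act (c : A) (x : free) : free :=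
  fglift (fun sa => gen sa.1 (c * sa.2)) x.

Fact free_actB c : {morph free_act c : x y / x - y}.
Proof. exact: lift_is_additive. Qed.

Fact free_act0 c : free_act c 0 = 0.
Proof. by rewrite -[X in free_act c X](subrr 0) free_actB subrr. Qed.

Fact free_actD c : {morph free_act c : x y / x + y}.
Proof.
move=> x y; have N z : free_act c (- z) = - free_act c z.
  by rewrite -[X in free_act c X]add0r free_actB free_act0 add0r.
by rewrite -{1}[y]opprK free_actB N opprK.
Qed.

Fact free_actU c s a : free_act c (gen s a) = gen s (c * a).
Proof. by rewrite /free_act liftU scale1r. Qed.

Fact free_ind (P : free -> Prop) :
  P 0 -> (forall x y, P x -> P y -> P (x - y)) ->
  (forall s a, P (gen s a)) -> forall x, P x.
Proof.
move=> P0 PB PU x; have PN z : P z -> P (- z).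
  by move=> Pz; rewrite -[- z]add0r; apply: PB.
have PD y z : P y -> P z -> P (y + z).
  by move=> Py Pz; rewrite -[z]opprK; apply: PB => //; exact: PN.
have PMn y m : P y -> P (y *+ m).
  by move=> Py; elim: m => [|m IHm]; rewrite ?mulr0n // mulrS; exact: PD.
rewrite -[x]freeg_sumE; elim/big_ind: _ => // -[s a] _.
have -> : << coeff (s, a) x *g (s, a) >> = gen s a *~ coeff (s, a) x.
  by apply/eqP/freeg_eqP => y; rewrite raddfMz /= !coeffU mul1r -mulrzl intz mulrC.
by case: (coeff _ _) => m; rewrite ?NegzE ?mulrNz -pmulrn; [|apply: PN]; apply: PMn.
Qed.

Fact free_act_rel c x : tensor_rel x -> tensor_rel (free_act c x).
Proof.
elim=> [|y z _ ry _ rz|s t a|s a b]; first by rewrite free_act0; exact: TensorRel0.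
- by rewrite free_actB; exact: TensorRelB.
- by rewrite free_actB free_actD !free_actU; exact: TensorRelDl.
- by rewrite free_actB free_actD !free_actU mulrDr; exact: TensorRelDr.
Qed.

Fact tensor_eqP (x y : free) :
  (\pi_tensor x = \pi_tensor y) <-> tensor_rel (x - y).
Proof.
split=> [/eqP|rxy]; first by rewrite -Quotient.idealrBE /in_mem /= => /asboolP.
by apply/eqP; rewrite -Quotient.idealrBE /in_mem /=; apply/asboolP.
Qed.

Fact pi_tensorD : {morph \pi_tensor : x y / x + y}.
Proof. exact: Quotient.pi_add. Qed.

Fact pi_tensorB : {morph \pi_tensor : x y / x - y}.
Proof. by move=> x y; rewrite pi_tensorD; congr (_ + _); exact: Quotient.pi_opp. Qed.

Definition tensor_scale (c : A) (u : tensor) : tensor :=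
  \pi_tensor (free_act c (repr u)).

Fact pi_tensor_scale c x :
  tensor_scale c (\pi_tensor x) = \pi_tensor (free_act c x).
Proof.
apply/tensor_eqP; rewrite -free_actB; apply/free_act_rel/tensor_eqP.
by rewrite reprK.
Qed.

Fact tens_Dl s t a : tens (s + t) a = tens s a + tens t a.
Proof.
by rewrite /tens -pi_tensorD; apply/tensor_eqP; exact: TensorRelDl.
Qed.

Fact tens_Dr s a b : tens s (a + b) = tens s a + tens s b.
Proof.
by rewrite /tens -pi_tensorD; apply/tensor_eqP; exact: TensorRelDr.
Qed.

Fact tensor_scale_tens c s a : tensor_scale c (tens s a) = tens s (c * a).
Proof. by rewrite pi_tensor_scale free_actU. Qed.

Fact tensor_scaleB c : {morph tensor_scale c : u v / u - v}.
Proof.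
move=> u v; rewrite -[u]reprK -[v]reprK -pi_tensorB.
by rewrite !pi_tensor_scale -pi_tensorB free_actB.
Qed.

Fact tensor_ind (P : tensor -> Prop) :
  P 0 -> (forall u v, P u -> P v -> P (u - v)) ->
  (forall s a, P (tens s a)) -> forall u, P u.
Proof.
move=> P0 PB PU u; rewrite -[u]reprK; elim/free_ind: (repr u) => [|x y Px Py|//].
  by rewrite (_ : \pi_tensor 0 = 0) // -(subrr 0) pi_tensorB subrr.
by rewrite pi_tensorB; exact: PB.
Qed.

Fact tensor_scale0 c : tensor_scale c 0 = 0.
Proof. by rewrite -[X in tensor_scale c X](subrr 0) tensor_scaleB subrr. Qed.

Fact tensor_scaleA c d u :
  tensor_scale c (tensor_scale d u) = tensor_scale (c * d) u.
Proof.
elim/tensor_ind: u => [|u v IHu IHv|s a]; first by rewrite !tensor_scale0.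
  by rewrite !tensor_scaleB IHu IHv.
by rewrite !tensor_scale_tens mulrA.
Qed.

Fact tensor_scale1 : left_id 1 tensor_scale.
Proof.
elim/tensor_ind => [|u v IHu IHv|s a]; first by rewrite tensor_scale0.
  by rewrite tensor_scaleB IHu IHv.
by rewrite tensor_scale_tens mul1r.
Qed.

Fact tensor_scaleDr : right_distributive tensor_scale +%R.
Proof.
move=> c u v; have N w : tensor_scale c (- w) = - tensor_scale c w.
  by rewrite -[X in tensor_scale c X]add0r tensor_scaleB tensor_scale0 add0r.
by rewrite -{1}[v]opprK tensor_scaleB N opprK.
Qed.

Fact tensor_scaleDl u : {morph tensor_scale^~ u : c d / c + d}.
Proof.
move=> c d; elim/tensor_ind: u => [|u v IHu IHv|s a].
- by rewrite !tensor_scale0 addr0.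
- by rewrite !tensor_scaleB IHu IHv opprD addrACA.
- by rewrite !tensor_scale_tens mulrDl tens_Dr.
Qed.

HB.instance Definition _ := GRing.Zmodule_isLmodule.Build A tensor
  tensor_scaleA tensor_scale1 tensor_scaleDr tensor_scaleDl.
End Tensor.

Definition has_dim (K : fieldType) (V : lmodType K) (r : nat) : Prop :=
  exists b : 'I_r -> V,
    forall v : V, exists! c : 'rV[K]_r, v = \sum_(i < r) c 0 i *: b i.

Definition symmx_prob (R : realType) (F : finFieldType) (n : nat)
    (E : pred 'M[F]_n) : R :=
  #|[set H : 'M[F]_n | (H^T == H) && E H]|%:R
    / #|[set H : 'M[F]_n | H^T == H]|%:R.

Local Open Scope classical_set_scope.

(* Like every lim, this is meaningful only when the partial products converge. *)
Definition infprod (R : realType) (m : nat) (f : nat -> R) : R :=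
  lim (\prod_(m <= i < N) f i @[N --> \oo]).

(* Main.v *)
Require Import Defs.
From mathcomp Require Import freeg.
From mathcomp Require Import boolp classical_sets reals topology normedtype.
From mathcomp Require Import sequences exp.
From mathcomp Require Import all_boot all_order all_algebra.
From mathcomp Require Import generic_quotient ring_quotient.
From mathcomp Require Import mxabelem algC complex.
From mathcomp Require Import ring lra zify.

Set Implicit Arguments.
Unset Strict Implicit.
Unset Printing Implicit Defensive.

Import Order.TTheory GRing.Theory Num.Theory numFieldNormedType.Exports.

(**
The proof is by moments. Both coranks are coranks D of a random symmetric
matrix M over F_p: for the sandpile group, M is the reduced Laplacian, because
S (x) F_p is its cokernel. If M has size N, the number of N x k matrices V of
rank k with M V = 0 is prod_(i < k) (p^D - p^i), and its expectation tends to
p^(k(k-1)/2) in both models. Expanding the indicator of M V = 0 in additive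
characters turns this expectation into p^(-Nk) times a sum over pairs (C, V);
the pairs with C V^T alternating give the main term, p^(k(k-1)/2) for each V.
For a uniform symmetric matrix the other pairs contribute 0. For G(n,q), the
pair is a map w from the vertices to the hyperbolic space F_p^k x F_p^k, each
pair of vertices i, j with (c_i - c_j).(v_i - v_j) <> 0 contributes a factor
of modulus less than 1, and since a set without such pairs has at most p^k
points, the maps w with such a pair contribute o(p^(kN)).

These moments determine the law of D, because the q-analogues of Bonferroni's
inequalities bracket P(D = r) by finite combinations of moments whose error
terms tend to 0; Euler's identity for sum (-1)^j x^j / ((1-x)...(1-x^j))
identifies the limit.
*)

Local Open Scope ring_scope.

(** * Weighted sums over maps that are not cliques *)

Section CliqueSums.
Variables (R : realFieldType) (X : finType) (cp : rel X) (K : nat) (sg : R).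
Hypotheses (cp_refl : reflexive cp) (cp_sym : symmetric cp).
Hypothesis clique_le : forall H : {set X}, {in H &, forall x y, cp x y} -> (#|H| <= K)%N.
Hypotheses (K_gt0 : (0 < K)%N) (sg_ge0 : 0 <= sg) (sg_lt1 : sg < 1).

(** The pairs are ordered, so each conflict between two indices counts twice; this is why a factor
    of a single edge is later bounded by [sg ^+ 2]. *)
Definition conflicts (n : nat) (w : {ffun 'I_n -> X}) : {set 'I_n * 'I_n} :=
  [set ij | ~~ cp (w ij.1) (w ij.2)].

Definition outliers (n : nat) (H : {set X}) (w : {ffun 'I_n -> X}) : {set 'I_n} :=
  [set i | w i \notin H].

Local Notation fiber w x := [set i | w i == x].
Local Notation m := #|X|.

Lemma card_fiber_conflicts (n : nat) (w : {ffun 'I_n -> X}) (x y : X) :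
  ~~ cp x y -> (#|fiber w x| * #|fiber w y| <= #|conflicts w|)%N.
Proof.
move=> xy; rewrite -cardsX; apply: subset_leq_card; apply/subsetP => -[i j].
by rewrite !inE /= => /andP[/eqP-> /eqP->].
Qed.

(** A clique of the maximal size [K] cannot be enlarged, so the value at an outlier conflicts with
    some [h] in [H], and the outlier conflicts with the at least [t] indices in the fiber of [h]. *)
Lemma card_outliers_conflicts (n t : nat) (H : {set X}) (w : {ffun 'I_n -> X}) :
  {in H &, forall x y, cp x y} -> #|H| = K -> (forall x, x \in H -> (t <= #|fiber w x|)%N) ->
  (t * #|outliers H w| <= #|conflicts w|)%N.
Proof.
move=> clH cardH big.
have ex i : i \in outliers H w -> exists h, (h \in H) && ~~ cp (w i) h.
  rewrite inE => iH; apply/existsP; apply: contraT => /existsPn noh.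
  have comp h : h \in H -> cp (w i) h.
    by move=> hH; have := noh h; rewrite hH /= negbK.
  have := clique_le (H := w i |: H); rewrite cardsU1 iH cardH add1n ltnn; apply.
  move=> x y /setU1P[->|xH] /setU1P[->|yH]; rewrite ?cp_refl ?comp //.
    by rewrite cp_sym comp.
  exact: clH.
have -> : #|conflicts w| = (\sum_i #|[set j | ~~ cp (w i) (w j)]|)%N.
  rewrite -sum1_card (eq_bigl (fun ij : 'I_n * 'I_n => ~~ cp (w ij.1) (w ij.2))).
    rewrite -(pair_big_dep xpredT (fun i j => ~~ cp (w i) (w j)) (fun _ _ => 1%N)) /=.
    by apply: eq_bigr => i _; rewrite -sum1_card; apply: eq_bigl => j; rewrite inE.
  by move=> ij; rewrite inE.
rewrite mulnC -sum_nat_const big_mkcond; apply: leq_sum => i _.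
case: ifP => // /ex [h /andP[hH hi]].
apply: leq_trans (big h hH) _; apply: subset_leq_card; apply/subsetP => j.
by rewrite !inE => /eqP->.
Qed.

(* Call a point heavy if [w] takes it at least [t] times. The three terms bound
   the case of two conflicting heavy points (there are then [t * t] conflicts),
   of a clique of fewer than [K] heavy points (few indices are outliers), and
   of a heavy clique of size [K], where each outlier conflicts with a heavy
   point. *)
Lemma conflict_weight_le (n t : nat) (lam : R) (w : {ffun 'I_n -> X}) :
  0 < lam <= 1 -> conflicts w != set0 ->
  sg ^+ #|conflicts w| <= sg ^+ (t * t)
    + \sum_(H : {set X} | (#|H| < K)%N) lam ^+ #|outliers H w| / lam ^+ (m * t)
    + \sum_(H : {set X} | #|H| == K)
        (if outliers H w == set0 then 0 else (sg ^+ t) ^+ #|outliers H w|).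
Proof.
move=> /andP[lam0 lam1] bad.
have sgX k : 0 <= sg ^+ k by rewrite exprn_ge0.
have le1 : sg <= 1 by exact: ltW.
have T2 : 0 <= \sum_(H : {set X} | (#|H| < K)%N) lam ^+ #|outliers H w| / lam ^+ (m * t).
  by apply: sumr_ge0 => H _; rewrite divr_ge0 // exprn_ge0 // ltW.
have T3i H : 0 <= (if outliers H w == set0 then 0 else (sg ^+ t) ^+ #|outliers H w|).
  by case: ifP => // _; rewrite exprn_ge0.
have T3 : 0 <= \sum_(H : {set X} | #|H| == K)
        (if outliers H w == set0 then 0 else (sg ^+ t) ^+ #|outliers H w|).
  by apply: sumr_ge0.
pose H := [set x | (t <= #|fiber w x|)%N].
have [clH|] := boolP [forall x in H, forall y in H, cp x y]; last first.
  rewrite negb_forall_in => /exists_inP[x xH]; rewrite negb_forall_in => /exists_inP[y yH] xy.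
  have e : (t * t <= #|conflicts w|)%N.
    apply: leq_trans (card_fiber_conflicts w xy).
    by move: xH yH; rewrite !inE => *; exact: leq_mul.
  have h : sg ^+ #|conflicts w| <= sg ^+ (t * t) by exact: ler_wiXn2l.
  by rewrite -addrA; apply: le_trans h _; rewrite lerDl addr_ge0.
have {}clH : {in H &, forall x y, cp x y}.
  by move=> x y xH yH; move/forall_inP: clH => /(_ x xH)/forall_inP/(_ y yH).
have := clique_le clH; rewrite leq_eqVlt => /orP[/eqP cardH|ltH].
  have e : (t * #|outliers H w| <= #|conflicts w|)%N.
    by apply: card_outliers_conflicts => // x; rewrite inE.
  (* Without outliers all values would lie in the clique [H], leaving no conflict. *)
  have o : outliers H w != set0.
    apply: contraNneq bad => o0; apply/eqP/setP => -[i j]; rewrite !inE /=.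
    apply/negbTE; rewrite negbK; apply: clH.
      by move/setP/(_ i): o0; rewrite !inE => /negbT; rewrite negbK.
    by move/setP/(_ j): o0; rewrite !inE => /negbT; rewrite negbK.
  rewrite [X in _ + X](bigD1 H) ?cardH //= (negbTE o) -exprM.
  have h : sg ^+ #|conflicts w| <= sg ^+ (t * #|outliers H w|) by exact: ler_wiXn2l.
  apply: le_trans h _; rewrite addrCA lerDl addr_ge0 //; first by rewrite addr_ge0.
  by apply: sumr_ge0.
(* Each value outside [H] is taken fewer than [t] times, so the quotient in the second term is at
   least 1. *)
have o : (#|outliers H w| <= m * t)%N.
  have -> : #|outliers H w| = (\sum_(x | x \notin H) #|fiber w x|)%N.
    rewrite -sum1_card (partition_big (fun i => w i) (fun x => x \notin H)) /=; last first.
      by move=> i; rewrite inE.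
    apply: eq_bigr => x xH; rewrite -sum1_card; apply: eq_bigl => i.
    by rewrite !inE; case: eqP => [->|]; rewrite ?andbF //; move: xH; rewrite inE => ->.
  apply: (@leq_trans (\sum_(x | x \notin H) t)%N).
    by apply: leq_sum => x; rewrite inE -ltnNge => /ltnW.
  by rewrite sum_nat_const leq_mul2r max_card orbT.
rewrite (bigD1 H) //=.
have h1 : 1 <= lam ^+ #|outliers H w| / lam ^+ (m * t).
  by rewrite ler_pdivlMr ?exprn_gt0 // mul1r ler_wiXn2l // ltW.
have h2 : sg ^+ #|conflicts w| <= 1 by rewrite exprn_ile1.
apply: le_trans h2 _; apply: le_trans h1 _.
rewrite -!addrA addrCA lerDl; do !apply: addr_ge0 => //.
by apply: sumr_ge0 => ? _; rewrite divr_ge0 // exprn_ge0 // ltW.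
Qed.

(** The weight is a product over the indices, so the sum over all maps factors. *)
Lemma sum_outliers (n : nat) (H : {set X}) (s : R) :
  \sum_(w : {ffun 'I_n -> X}) s ^+ #|outliers H w| = (#|H|%:R + #|~: H|%:R * s) ^+ n.
Proof.
transitivity (\sum_(w : {ffun 'I_n -> X}) \prod_i (if w i \in H then 1 else s)).
  apply: eq_bigr => w _; rewrite (eq_bigr (fun i => if i \in outliers H w then s else 1)).
    by rewrite -big_mkcond prodr_const.
  by move=> i _; rewrite inE; case: (w i \in H).
rewrite -(bigA_distr_bigA (fun _ x => if x \in H then 1 else s)) prodr_const card_ord.
congr (_ ^+ _); rewrite (bigID (mem H)) /=; congr (_ + _).
  by rewrite (eq_bigr (fun=> 1)) ?sumr_const // => i ->.
rewrite (eq_bigr (fun=> s)) => [|i /negbTE-> //].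
by rewrite (eq_bigl (mem (~: H))) ?sumr_const ?mulr_natl // => i; rewrite /= inE.
Qed.

Lemma conflict_sum_le (n t : nat) :
  \sum_(w : {ffun 'I_n -> X} | conflicts w != set0) sg ^+ #|conflicts w| <=
   m%:R ^+ n * sg ^+ (t * t)
   + (2 ^ m)%:R * ((K%:R - 1 / 2) ^+ n * (2 * m.+1%:R) ^+ (m * t))
   + (2 ^ m)%:R * ((K%:R + m%:R * sg ^+ t) ^+ n - K%:R ^+ n).
Proof.
(* With this [lam] the values outside [H] weigh at most 1/2 in total; together with at most [K - 1]
   values in [H] they give the base [K - 1 / 2]. *)
pose lam : R := (2 * m.+1%:R)^-1.
have m1 : 1 <= m.+1%:R :> R by rewrite ler1n.
have lamP : 0 < lam <= 1.
  by apply/andP; split; [rewrite invr_gt0|rewrite invf_le1]; lra.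
have lam0 : 0 < lam by case/andP: lamP.
apply: le_trans (ler_sum _ (fun w => conflict_weight_le t lamP)) _.
apply: (@le_trans _ _ (\sum_(w : {ffun 'I_n -> X}) (sg ^+ (t * t)
    + \sum_(H : {set X} | (#|H| < K)%N) lam ^+ #|outliers H w| / lam ^+ (m * t)
    + \sum_(H : {set X} | #|H| == K)
        (if outliers H w == set0 then 0 else (sg ^+ t) ^+ #|outliers H w|)))).
  rewrite [leLHS]big_mkcond; apply: ler_sum => w _; case: ifP => // _.
  do ?apply: addr_ge0; rewrite ?exprn_ge0 //.
    by apply: sumr_ge0 => H _; rewrite divr_ge0 // exprn_ge0 // ltW.
  by apply: sumr_ge0 => H _; case: ifP => // _; rewrite !exprn_ge0.
have cardSub (Q : pred {set X}) (c : R) : 0 <= c -> \sum_(H : {set X} | Q H) c <= (2 ^ m)%:R * c.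
  move=> c0; rewrite sumr_const -[leLHS]mulr_natl ler_wpM2r // ler_nat.
  apply: leq_trans (max_card _) _.
  by rewrite -cardsT -powersetT card_powerset cardsT.
rewrite !big_split /=; apply: lerD; first apply: lerD.
- by rewrite sumr_const card_ffun card_ord -natrX mulr_natl.
- rewrite exchange_big /=.
  have c0 : 0 <= (K%:R - 1 / 2) ^+ n * (2 * m.+1%:R) ^+ (m * t) :> R.
    have K1 : 1 <= K%:R :> R by rewrite ler1n.
    by rewrite mulr_ge0 // exprn_ge0 //; lra.
  apply: le_trans (cardSub (fun H => (#|H| < K)%N) _ c0); apply: ler_sum => H HK.
  rewrite -mulr_suml sum_outliers -exprVn invrK ler_wpM2r ?exprn_ge0 //; first by lra.
  have HK' : #|H|%:R <= K%:R - 1 :> R by rewrite lerBrDr natr1 ler_nat.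
  have CH : #|~: H|%:R * lam <= 1 / 2.
    have h : #|~: H|%:R <= m.+1%:R :> R by rewrite ler_nat leqW // max_card.
    by rewrite /lam ler_pdivrMr; lra.
  have a : 0 <= #|H|%:R + #|~: H|%:R * lam by rewrite addr_ge0 // mulr_ge0 // ltW.
  have b : #|H|%:R + #|~: H|%:R * lam <= K%:R - 1 / 2 by lra.
  by rewrite lerXn2r ?nnegrE ?(le_trans a b).
- rewrite exchange_big /=.
  have c0 : 0 <= (K%:R + m%:R * sg ^+ t) ^+ n - K%:R ^+ n.
    have h : 0 <= m%:R * sg ^+ t by rewrite mulr_ge0 ?exprn_ge0.
    by rewrite subr_ge0 lerXn2r ?nnegrE ?addr_ge0 // lerDl.
  apply: le_trans (cardSub (fun H => #|H| == K) _ c0); apply: ler_sum => H /eqP HK.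
  (* [0 ^+ #|outliers H w|] is the indicator of having no outlier, so the sum becomes a difference
     of two instances of [sum_outliers]. *)
  have -> : \sum_(w : {ffun 'I_n -> X}) (if outliers H w == set0 then 0
      else (sg ^+ t) ^+ #|outliers H w|) =
      \sum_(w : {ffun 'I_n -> X}) (sg ^+ t) ^+ #|outliers H w|
    - \sum_(w : {ffun 'I_n -> X}) 0 ^+ #|outliers H w|.
    rewrite -sumrB; apply: eq_bigr => w _; rewrite -cards_eq0.
    by case: #|_| => [|k] /=; rewrite ?expr0 ?subrr // [0 ^+ _]expr0n subr0.
  rewrite !sum_outliers mulr0 addr0 HK lerD2r lerXn2r ?nnegrE ?addr_ge0 ?mulr_ge0 ?exprn_ge0 //.
  by rewrite lerD2l ler_wpM2r ?exprn_ge0 // ler_nat max_card.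
Qed.
End CliqueSums.

(** * Counting matrices over a finite field *)

Section FiniteFieldCounts.
Variable F : finFieldType.
Local Notation q := #|F|.

Lemma card_submx (m N : nat) (A : 'M[F]_(m, N)) :
  #|[set u : 'rV[F]_N | (u <= A)%MS]| = (q ^ \rank A)%N.
Proof. by rewrite -card_rowg; apply: eq_card => u; rewrite !inE. Qed.

Lemma row_free_col_mx (k N : nat) (u : 'rV[F]_N) (W : 'M[F]_(k, N)) :
  row_free (col_mx u W) = row_free W && ~~ (u <= W)%MS.
Proof.
rewrite /row_free -addsmxE; have S := mxrank_sum_cap u W.
have uc : (\rank (u :&: W) <= \rank u)%N by rewrite mxrankS // capmxSl.
have ur := rank_leq_row u; have wr := rank_leq_row W.
have [uW|uW] := boolP (u <= W)%MS.
  have -> : \rank (u + W)%MS = \rank W by case/addsmx_idPr: uW.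
  by rewrite andbF; apply/negbTE; rewrite neq_ltn ltnS wr.
rewrite andbT; have uc' : \rank (u :&: W) != \rank u.
  apply: contra uW; rewrite (mxrank_leqif_sup (capmxSl u W)) => h.
  exact: submx_trans h (capmxSr _ _).
by apply/eqP/eqP; lia.
Qed.

(** Rows are chosen one at a time, each in the row space of [A] and outside the span of those
    already chosen. Truncated subtraction is harmless: if [k] exceeds the rank, some factor is 0. *)
Lemma card_row_free_submx (k m N : nat) (A : 'M[F]_(m, N)) :
  #|[set W : 'M[F]_(k, N) | row_free W && (W <= A)%MS]|
  = (\prod_(i < k) (q ^ \rank A - q ^ i))%N.
Proof.
elim: k => [|k IH].
  rewrite big_ord0; transitivity #|{: 'M[F]_(0, N)}|; last by rewrite card_mx.
  apply: eq_card => W.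
  by rewrite !inE [W]flatmx0 sub0mx /row_free mxrank0 eqxx.
rewrite big_ord_recr /= -IH.
pose f (uW : 'rV[F]_N * 'M[F]_(k, N)) : 'M[F]_(1 + k, N) := col_mx uW.1 uW.2.
have finj : injective f by move=> [u W] [u' W']; rewrite /f /= => /eq_col_mx[-> ->].
pose T := [set uW | row_free (f uW) && (f uW <= A)%MS].
have -> : [set W : 'M[F]_(k.+1, N) | row_free W && (W <= A)%MS] = f @: T.
  apply/setP => W; apply/idP/imsetP => [|[uW + ->]]; last by rewrite !inE.
  rewrite inE => WA; exists (usubmx (W : 'M_(1 + k, N)), dsubmx (W : 'M_(1 + k, N))).
    by rewrite inE /f /= vsubmxK.
  by rewrite /f /= vsubmxK.
rewrite card_imset // -sum1_card.
rewrite (eq_bigl (fun uW : _ * _ => (row_free uW.2 && (uW.2 <= A)%MS)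
   && ((uW.1 <= A)%MS && ~~ (uW.1 <= uW.2)%MS))); last first.
  move=> [u W]; rewrite !inE /f /= row_free_col_mx col_mx_sub.
  by case: row_free; case: (u <= W)%MS; case: (u <= A)%MS; case: (W <= A)%MS.
rewrite (reindex_onto (fun Wu : 'M[F]_(k, N) * 'rV[F]_N => (Wu.2, Wu.1))
  (fun uW => (uW.2, uW.1))) /=; last by case.
rewrite (eq_bigl (fun Wu : _ * _ => (row_free Wu.1 && (Wu.1 <= A)%MS)
   && ((Wu.2 <= A)%MS && ~~ (Wu.2 <= Wu.1)%MS))); last by case=> ? ? /=; rewrite eqxx andbT.
rewrite -(pair_big_dep (fun W => row_free W && (W <= A)%MS)
  (fun W u => (u <= A)%MS && ~~ (u <= W)%MS) (fun _ _ => 1%N)) /=.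
rewrite -sum_nat_const [RHS](eq_bigl (fun W => row_free W && (W <= A)%MS)); last first.
  by move=> W; rewrite inE.
apply: eq_bigr => W /andP[/eqP Wk WA].
rewrite -(card_submx A) -[in X in (_ - q ^ X)%N]Wk -(card_submx W) sum1_card.
rewrite -(cardsID [set u : 'rV[F]_N | (u <= W)%MS] [set u : 'rV[F]_N | (u <= A)%MS]).
rewrite (_ : _ :&: _ = [set u : 'rV[F]_N | (u <= W)%MS]); last first.
  apply/setP => u; rewrite !inE andbC; case: (boolP (u <= W)%MS) => //= uW.
  exact: submx_trans uW WA.
by rewrite addKn; apply: eq_card => u; rewrite !inE andbC.
Qed.

(** As [M] is symmetric, transposing turns [V] into a row-free matrix inside the left kernel of
    [M]. *)
Lemma card_full_kermx (k N : nat) (M : 'M[F]_N) : M^T = M ->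
  #|[set V : 'M[F]_(N, k) | row_full V && (M *m V == 0)]|
  = (\prod_(i < k) (q ^ (N - \rank M) - q ^ i))%N.
Proof.
move=> Msym; rewrite -mxrank_ker -card_row_free_submx -(card_imset _ (@trmx_inj F N k)).
apply: eq_card => W; rewrite inE; apply/imsetP/idP => [[V]|/andP[fW]].
  rewrite inE => /andP[fV /eqP MV] ->; rewrite /row_free mxrank_tr; apply/andP; split => //.
  by apply/sub_kermxP; rewrite -[M]Msym -trmx_mul MV trmx0.
move=> /sub_kermxP WM; exists W^T; last by rewrite trmxK.
rewrite inE /row_full mxrank_tr; apply/andP; split => //.
by rewrite -[M]Msym -trmx_mul WM trmx0.
Qed.

(** The diagonal is constrained separately because antisymmetry does not make it vanish in
    characteristic 2. *)
Definition alternating (k : nat) (A : 'M[F]_k) : bool :=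
  [forall i, A i i == 0] && (A^T == - A).

Lemma alternatingP (k : nat) (A : 'M[F]_k) :
  reflect (exists T, A = T - T^T) (alternating A).
Proof.
apply: (iffP andP) => [[/forallP d /eqP s]|[T ->]]; last first.
  split; first by apply/forallP => i; rewrite !mxE subrr.
  by rewrite linearB /= trmxK opprB.
(* The strictly upper triangular part serves in every characteristic, with no division by 2. *)
exists (\matrix_(i, j) if (i < j)%N then A i j else 0).
apply/matrixP => i j; rewrite !mxE; have := congr1 (fun B : 'M_k => B i j) s.
rewrite !mxE => sij; case: (ltngtP i j) => [||/val_inj ->].
- by rewrite subr0.
- by rewrite sub0r sij opprK.
- by rewrite subrr (eqP (d j)).
Qed.

Lemma alternating_congr (k l : nat) (B : 'M[F]_(l, k)) (A : 'M[F]_k) :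
  alternating A -> alternating (B *m A *m B^T).
Proof.
move=> /alternatingP[T ->]; apply/alternatingP; exists (B *m T *m B^T).
by rewrite mulmxBr mulmxBl !trmx_mul trmxK mulmxA.
Qed.

Lemma card_alternating (k : nat) : #|[set A : 'M[F]_k | alternating A]| = (q ^ 'C(k, 2))%N.
Proof.
elim: k => [|k IH].
  transitivity #|{: 'M[F]_(0, 0)}|; last by rewrite card_mx.
  apply: eq_card => A; rewrite !inE.
  by apply/alternatingP; exists 0; rewrite [RHS]thinmx0 thinmx0.
rewrite binS bin1 expnD -IH -[X in (_ * q ^ X)%N]mul1n -card_mx -cardsT mulnC -cardsX.
pose f (uA : 'rV[F]_k * 'M[F]_k) : 'M[F]_(1 + k) := block_mx 0 uA.1 (- uA.1^T) uA.2.
have finj : injective f by move=> [u A] [u' A']; rewrite /f /= => /eq_block_mx[_ -> _ ->].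
rewrite -(card_imset _ finj); apply: eq_card => A; rewrite inE.
move: A; change k.+1 with (1 + k)%N => A.
apply/idP/imsetP => [altA|[[u B]]]; last first.
  rewrite !inE /= => /alternatingP[T ->] ->; apply/alternatingP.
  exists (block_mx 0 u 0 T : 'M_(1 + k, 1 + k));
  rewrite /f /= tr_block_mx opp_block_mx add_block_mx.
  by rewrite !trmx0 !subr0 add0r.
exists (ursubmx A, drsubmx A).
  rewrite !inE /=; move/alternatingP: altA => [T ->]; apply/alternatingP.
  by exists (drsubmx T); apply/matrixP => i j; rewrite !mxE.
rewrite /f /= -[LHS]submxK; case/andP: altA => /forallP d /eqP s; congr block_mx.
  by apply/matrixP => i j; rewrite !mxE !ord1 (eqP (d _)).
apply/matrixP => i j; rewrite !mxE;
have := congr1 (fun B : 'M_(1 + k) => B (rshift 1 i) (lshift k j)) s.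
by rewrite !mxE => ->; rewrite opprK.
Qed.

(** [V] has a left inverse [B], and the solutions [C] are exactly the products [V *m A] with [A]
    alternating. *)
Lemma card_alternating_mul (k N : nat) (V : 'M[F]_(N, k)) : row_full V ->
  #|[set C : 'M[F]_(N, k) | alternating (C *m V^T)]| = (q ^ 'C(k, 2))%N.
Proof.
move=> fV; pose B := pinvmx V; have BV : B *m V = 1%:M by exact: mulVpmx.
have finj : injective (fun A : 'M[F]_k => V *m A).
  by move=> A A' /(congr1 (mulmx B)); rewrite !mulmxA BV !mul1mx.
rewrite -card_alternating -(card_imset _ finj); apply: eq_card => C.
apply/idP/imsetP => [|[A + ->]]; last by rewrite !inE; exact: alternating_congr.
rewrite inE => altC.
have CE : C = C *m V^T *m B^T by rewrite -mulmxA -trmx_mul BV trmx1 mulmx1.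
exists (B *m C).
  by rewrite inE CE [B *m _]mulmxA; exact: alternating_congr.
case/andP: altC => _ /eqP; rewrite trmx_mul trmxK => s.
have s' : C *m V^T = - (V *m C^T) by rewrite s opprK.
have e : B *m C = - (C^T *m B^T) by rewrite {1}CE s' mulNmx mulmxN !mulmxA BV mul1mx.
by rewrite e mulmxN mulmxA {1}CE s' mulNmx.
Qed.

(* [x.1 *m x.2^T] is the hyperbolic quadratic form; cliques of this relation lie in
   translates of totally singular subspaces. *)
Definition hyperbolic_rel (k : nat) : rel ('rV[F]_k * 'rV[F]_k) :=
  [rel x y | (x.1 - y.1) *m (x.2 - y.2)^T == 0].

Lemma hyperbolic_rel_refl k : reflexive (@hyperbolic_rel k).
Proof. by move=> x; rewrite /hyperbolic_rel /= subrr mul0mx. Qed.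

Lemma hyperbolic_rel_sym k : symmetric (@hyperbolic_rel k).
Proof.
move=> x y; rewrite /hyperbolic_rel /= -[y.1 - _]opprB -[y.2 - _]opprB.
by rewrite linearN /= mulmxN mulNmx opprK.
Qed.

(** After translation by a point [h0] of [H], the members of [H] are pairwise orthogonal for the
    polar form. Hence the matrix [A] of these rows is killed by its transpose with the blocks
    exchanged, its rank is at most half of [k + k], and its row space contains a copy of [H]. *)
Lemma hyperbolic_clique_le (k : nat) (H : {set 'rV[F]_k * 'rV[F]_k}) :
  {in H &, forall x y, hyperbolic_rel x y} -> (#|H| <= q ^ k)%N.
Proof.
move=> clH; have [->|/set0Pn[h0 h0H]] := eqVneq H set0; first by rewrite cards0.
pose A1 : 'M[F]_(#|H|, k) := \matrix_i ((enum_val i).1 - h0.1).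
pose A2 : 'M[F]_(#|H|, k) := \matrix_i ((enum_val i).2 - h0.2).
pose A := row_mx A1 A2.
have A0 : A *m col_mx A2^T A1^T = 0.
  rewrite mul_row_col; apply/matrixP => i j.
  pose x := enum_val i; pose y := enum_val j.
  have xH : x \in H := enum_valP i; have yH : y \in H := enum_valP j.
  have E (B C : 'M[F]_(#|H|, k)) : (B *m C^T) i j = (row i B *m (row j C)^T) 0 0.
    by rewrite !mxE; apply: eq_bigr => l _; rewrite !mxE.
  rewrite mxE !E !rowK -/x -/y [RHS]mxE.
  (* The form vanishes at [x - h0], [y - h0] and [x - y]; expanding the last leaves only the two
     cross terms, so polarization needs no division by 2. *)
  have h1 := clH _ _ xH h0H; have h2 := clH _ _ yH h0H; have h3 := clH _ _ xH yH.
  have e (a b c : 'rV[F]_k) : a - b = (a - c) - (b - c) by rewrite opprB addrA subrK.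
  move: h1 h2 h3; rewrite /hyperbolic_rel /= (e x.1 y.1 h0.1) (e x.2 y.2 h0.2).
  move: (x.1 - h0.1) (x.2 - h0.2) (y.1 - h0.1) (y.2 - h0.2) => a b c d.
  rewrite linearB /= mulmxBr !mulmxBl => /eqP-> /eqP->.
  rewrite sub0r subr0 -opprD oppr_eq0 => /eqP/(congr1 (fun B : 'M_1 => B 0 0)).
  have -> : c *m b^T = b *m c^T.
    by rewrite -[LHS]trmxK trmx_mul trmxK; apply/matrixP => ? ?; rewrite !ord1 mxE.
  by rewrite !mxE addrC.
have rk : (\rank A <= k)%N.
  have := mulmx0_rank_max A0; rewrite -tr_row_mx mxrank_tr.
  have -> : \rank (row_mx A2 A1) = \rank A; last by lia.
  pose P : 'M[F]_(k + k) := block_mx 0 1%:M 1%:M 0.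
  have PP : P *m P = 1%:M.
    by rewrite mulmx_block !(mul0mx, mulmx0, mulmx1) !(add0r, addr0) -scalar_mx_block.
  have -> : row_mx A2 A1 = A *m P.
    by rewrite mul_row_block !(mulmx0, mulmx1) add0r addr0.
  by rewrite mxrankMfree // row_free_unit; case/mulmx1_unit: PP.
apply: (@leq_trans (q ^ \rank A)); last by rewrite leq_exp2l // card_finRing_gt1.
rewrite -card_submx.
have finj : injective (fun x : 'rV[F]_k * 'rV[F]_k => row_mx (x.1 - h0.1) (x.2 - h0.2)).
  by move=> [a b] [c d] /eq_row_mx [/addIr /= -> /addIr /= ->].
rewrite -[X in (X <= _)%N](card_imset H finj);
apply: subset_leq_card; apply/subsetP => _ /imsetP[x xH ->].
rewrite inE; have -> : row_mx (x.1 - h0.1) (x.2 - h0.2) = row (enum_rank_in xH x) A.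
  by rewrite row_row_mx !rowK enum_rankK_in.
exact: row_sub.
Qed.
End FiniteFieldCounts.

(** * Additive characters *)

(** A root [z] of 1 + X + ... + X^(p-1) is a p-th root of unity other than 1, and the character
    sends [a] to [z ^+ a]. The field stays general: [algC] serves for the exact count, [R[i]] for
    norm estimates. *)
Lemma Fp_character (C : numClosedFieldType) (p : nat) : prime p ->
  exists psi : 'F_p -> C, [/\ {morph psi : a b / a + b >-> a * b},
    forall a, (psi a == 1) = (a == 0) & forall a, `|psi a| = 1].
Proof.
move=> pp; have p1 := prime_gt1 pp.
have [z [z1 zp]] : exists z : C, z != 1 /\ z ^+ p = 1.
  have /closed_rootP[z] : size (\sum_(i < p) 'X^i : {poly C}) != 1%N.
    have -> : \sum_(i < p) 'X^i = \poly_(i < p) 1 :> {poly C}.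
      by rewrite poly_def; apply: eq_bigr => i _; rewrite scale1r.
    by rewrite size_poly_eq ?oner_neq0 // neq_ltn p1 orbT.
  rewrite /root horner_sum; under eq_bigr do rewrite hornerXn.
  move=> /eqP s0; exists z; split; last first.
    by apply/eqP; rewrite -subr_eq0 subrX1 s0 mulr0.
  apply: contra_eq_neq s0 => ->; under eq_bigr do rewrite expr1n.
  by rewrite sumr_const card_ord pnatr_eq0 -lt0n ltnW.
have zn : `|z| = 1.
  by apply/eqP; rewrite -(@pexpr_eq1 _ _ p) ?prime_gt0 // -normrX zp normr1.
exists (fun a => z ^+ (a : nat)); split.
- move=> a b; rewrite -exprD /= -[RHS](expr_mod _ zp).
  exact: (congr1 (fun n => z ^+ ((a + b) %% n)) (Fp_cast pp)).
- move=> a; have [m pm mp] := prim_order_exists (prime_gt0 pp) zp.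
  have mE : m = p.
    move: mp; case/primeP: pp => _ /[apply] /orP[]/eqP // m1.
    by move: pm z1; rewrite m1 => /prim_expr_order; rewrite expr1 => ->; rewrite eqxx.
  rewrite -(prim_order_dvd pm) mE; apply/idP/eqP => [pa|->]; last exact: dvdn0.
  have ap : (a < p)%N by rewrite -[X in (_ < X)%N](Fp_cast pp).
  apply/val_inj/eqP; rewrite /= -leqn0 leqNgt; apply/negP => a0.
  by have := dvdn_leq a0 pa; rewrite leqNgt ap.
- by move=> a; rewrite normrX zn expr1n.
Qed.

Section CharacterSums.
Variables (C : numClosedFieldType) (p : nat) (psi : 'F_p -> C).
Hypotheses (psiD : {morph psi : a b / a + b >-> a * b})
  (psi_eq1 : forall a, (psi a == 1) = (a == 0)).

Lemma character0 : psi 0 = 1. Proof. by apply/eqP; rewrite psi_eq1. Qed.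

Lemma character_sum (I : Type) (r : seq I) (P : pred I) (f : I -> 'F_p) :
  psi (\sum_(i <- r | P i) f i) = \prod_(i <- r | P i) psi (f i).
Proof. exact: (big_morph psi psiD character0). Qed.

(** Translation by [x0] multiplies the sum by [psi (f x0)], which is not 1. *)
Lemma character_sum_eq0 (G : finZmodType) (A : {set G}) (f : G -> 'F_p) (x0 : G) :
  {morph f : x y / x + y} -> (forall x, (x + x0 \in A) = (x \in A)) -> f x0 != 0 ->
  \sum_(x in A) psi (f x) = 0.
Proof.
move=> fD Ax0; rewrite -psi_eq1 => nz.
have E : \sum_(x in A) psi (f x) = \sum_(x in A) psi (f x) * psi (f x0).
  rewrite (reindex_inj (addIr x0)) /=; apply: eq_big => [x|x _]; first exact: Ax0.
  by rewrite fD psiD.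
move/eqP: E; rewrite -mulr_suml -subr_eq0 -[X in X - _]mulr1 -mulrBr mulf_eq0.
by rewrite subr_eq0 [1 == _]eq_sym (negbTE nz) orbF => /eqP.
Qed.

(** Orthogonality of characters: the elementary matrix at a nonzero entry of [T] shows that the
    trace pairing is nondegenerate. *)
Lemma mx_character_sum (N k : nat) (T : 'M['F_p]_(N, k)) :
  \sum_(D : 'M['F_p]_(N, k)) psi (\tr (D^T *m T)) = (T == 0)%:R * #|'F_p|%:R ^+ (N * k).
Proof.
have fD : {morph (fun D : 'M['F_p]_(N, k) => \tr (D^T *m T)) : x y / x + y}.
  by move=> x y; rewrite linearD mulmxDl linearD.
have [->|] := eqVneq T 0.
  under eq_bigr do rewrite mulmx0 linear0 character0.
  by rewrite sumr_const card_mx mul1r natrX.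
move=> T0; rewrite mul0r.
have [ij Tij] : exists ij, T ij.1 ij.2 != 0.
  apply/existsP; apply: contraNT T0 => /existsPn T0; apply/eqP/matrixP => i j.
  by rewrite mxE; apply/eqP; rewrite -[_ == _]negbK; exact: (T0 (i, j)).
rewrite (eq_bigl (mem [set: 'M['F_p]_(N, k)])); last by move=> D; rewrite /= inE.
apply: (character_sum_eq0 (x0 := delta_mx ij.1 ij.2) fD) => [D|]; first by rewrite !inE.
rewrite trmx_delta /mxtrace (bigD1 ij.2) //= big1 => [|l lj].
  rewrite addr0 mxE (bigD1 ij.1) //= big1 => [|l li]; last by rewrite mxE (negbTE li) andbF mul0r.
  by rewrite addr0 mxE !eqxx mul1r.
rewrite mxE big1 // => l' _; rewrite mxE (negbTE lj) mul0r //.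
Qed.

Lemma trace_swap (N k : nat) (H : 'M['F_p]_N) (D V : 'M['F_p]_(N, k)) :
  \tr (D^T *m (H *m V)) = \tr (H *m (D *m V^T)^T).
Proof. by rewrite trmx_mul trmxK mxtrace_mulC -mulmxA. Qed.

(** Under the trace pairing the symmetric matrices are annihilated exactly by the alternating ones:
    [T - T^T] pairs to 0 with them, while [delta_mx i i] or [delta_mx i j + delta_mx j i] detects
    any failure. *)
Lemma symmetric_character_sum (N k : nat) (D V : 'M['F_p]_(N, k)) :
  \sum_(H in [set H : 'M['F_p]_N | H^T == H]) psi (\tr (D^T *m (H *m V)))
  = (alternating (D *m V^T))%:R * #|[set H : 'M['F_p]_N | H^T == H]|%:R.
Proof.
under eq_bigr do rewrite trace_swap.
set A := D *m V^T; have [altA|] := boolP (alternating A).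
  have {altA}[T ->] := alternatingP _ altA.
  rewrite mul1r -sumr_const; apply: eq_bigr => H; rewrite inE => /eqP Hs.
  rewrite linearB /= trmxK mulmxBr linearB /= -[X in X - _]mxtrace_tr trmx_mul trmxK Hs.
  by rewrite mxtrace_mulC subrr character0.
have fD : {morph (fun H : 'M['F_p]_N => \tr (H *m A^T)) : x y / x + y}.
  by move=> x y; rewrite mulmxDl linearD.
have sub (H0 : 'M['F_p]_N) : H0^T = H0 -> forall H,
    (H + H0 \in [set H : 'M['F_p]_N | H^T == H]) = (H \in [set H : 'M['F_p]_N | H^T == H]).
  by move=> s H; rewrite !inE linearD /= s (inj_eq (addIr _)).
have trd i j (B : 'M['F_p]_N) : \tr (delta_mx i j *m B) = B j i.
  rewrite /mxtrace (bigD1 i) //= big1 => [|l li].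
    rewrite addr0 mxE (bigD1 j) //= big1 => [|l lj]; last by rewrite mxE (negbTE lj) andbF mul0r.
    by rewrite addr0 mxE !eqxx mul1r.
  by rewrite mxE big1 // => l' _; rewrite mxE (negbTE li) mul0r.
rewrite mul0r negb_and => /orP[/forallPn[i Aii]|].
  apply: (character_sum_eq0 (x0 := delta_mx i i) fD); first by apply: sub; rewrite trmx_delta.
  by rewrite trd mxE.
move=> As; have [ij Aij] : exists ij, A ij.1 ij.2 + A ij.2 ij.1 != 0.
  apply/existsP; apply: contraNT As => /existsPn z; apply/eqP/matrixP => i j.
  have := z (i, j); rewrite negbK /= addr_eq0 => /eqP e.
  by rewrite [LHS]mxE [RHS]mxE e opprK.
apply: (character_sum_eq0 (x0 := delta_mx ij.1 ij.2 + delta_mx ij.2 ij.1) fD).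
  by apply: sub; rewrite linearD /= !trmx_delta addrC.
by rewrite mulmxDl linearD /= !trd ![A^T _ _]mxE.
Qed.
End CharacterSums.

Section KernelCount.
Variables (C : numClosedFieldType) (p : nat) (psi : 'F_p -> C).
Hypotheses (psiD : {morph psi : a b / a + b >-> a * b})
  (psi_eq1 : forall a, (psi a == 1) = (a == 0)).

Lemma kernel_count_character (N k : nat) (M : 'M['F_p]_N) :
  #|[set V : 'M['F_p]_(N, k) | row_full V && (M *m V == 0)]|%:R * #|'F_p|%:R ^+ (N * k)
  = \sum_(V : 'M['F_p]_(N, k) | row_full V) \sum_(D : 'M['F_p]_(N, k))
      psi (\tr (D^T *m (M *m V))) :> C.
Proof.
under eq_bigr do rewrite (mx_character_sum psiD psi_eq1).
rewrite -mulr_suml; congr (_ * _); rewrite -sum1_card natr_sum.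
rewrite (eq_bigl (fun V => row_full V && (M *m V == 0))) => [|V]; last by rewrite inE.
by rewrite big_mkcondr; apply: eq_bigr => V _; case: eqP.
Qed.
End KernelCount.

Lemma card_row_full (F : finFieldType) (N k : nat) :
  #|[set V : 'M[F]_(N, k) | row_full V]| = (\prod_(i < k) (#|F| ^ N - #|F| ^ i))%N.
Proof.
have := @card_full_kermx F k N 0 (trmx0 _ _ _); rewrite mxrank0 subn0 => <-.
by apply: eq_card => V; rewrite !inE mul0mx eqxx andbT.
Qed.

(** Once the sums are exchanged only the pairs with [D *m V^T] alternating survive, so the moment is
    exact for every [N]. Multiplying by [p ^ (N * k)] keeps the identity among natural numbers,
    where it is deduced from [algC]. *)
Lemma symmetric_kernel_count (p N k : nat) : prime p ->
  ((\sum_(H in [set H : 'M['F_p]_N | H^T == H])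
     #|[set V : 'M['F_p]_(N, k) | row_full V && (H *m V == 0%R)]|) * p ^ (N * k)
  = #|[set H : 'M['F_p]_N | H^T == H]| * ((\prod_(i < k) (p ^ N - p ^ i)) * p ^ 'C(k, 2)))%N.
Proof.
move=> pp; have [psi [psiD psi1 _]] := Fp_character algC pp.
apply/eqP; rewrite -(eqr_nat algC) natrM natr_sum mulr_suml.
have q : #|'F_p| = p by exact: card_Fp.
have qX : (p ^ (N * k))%:R = #|'F_p|%:R ^+ (N * k) :> algC by rewrite q natrX.
rewrite qX; under eq_bigr do rewrite (kernel_count_character psiD psi1).
rewrite exchange_big /=; under eq_bigr do rewrite exchange_big /=.
under eq_bigr do under eq_bigr do rewrite (symmetric_character_sum psiD psi1).
have inner (V : 'M['F_p]_(N, k)) : row_full V ->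
    \sum_(D : 'M['F_p]_(N, k)) (alternating (D *m V^T))%:R *
      #|[set H : 'M['F_p]_N | H^T == H]|%:R
    = (#|[set H : 'M['F_p]_N | H^T == H]| * p ^ 'C(k, 2))%:R :> algC.
  move=> fV; rewrite -mulr_suml -natr_sum -natrM mulnC; congr (_ * _)%:R.
  rewrite -[X in (X ^ _)%N]q -(card_alternating_mul fV) -sum1_card.
  rewrite [RHS](eq_bigl (fun D => alternating (D *m V^T))) => [|D]; last by rewrite inE.
  by rewrite [RHS]big_mkcond; apply: eq_bigr => D _; case: ifP.
rewrite (eq_bigr _ inner)
  (eq_bigl (mem [set V : 'M['F_p]_(N, k) | row_full V])) => [|V]; last first.
  by rewrite /= inE.
rewrite sumr_const card_row_full -mulrnA eqr_nat -mulnA; apply/eqP; congr (_ * _)%N.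
by rewrite mulnC; congr (_ * _)%N; apply: eq_bigr => i _; rewrite q.
Qed.

(** * The sandpile group modulo p *)

Local Open Scope quotient_scope.

(** Two bases give a bijection between the coordinate spaces, and over a finite field counting
    points compares their dimensions. *)
Lemma has_dim_inj (K : finFieldType) (V : lmodType K) (r d : nat) :
  has_dim V r -> has_dim V d -> r = d.
Proof.
move=> [b Hb] [c Hc].
have bas (e : nat) (x : 'I_e -> V) :
    (forall v, exists! u : 'rV[K]_e, v = \sum_(i < e) u 0 i *: x i) ->
    exists f : V -> 'rV[K]_e, cancel f (fun u => \sum_(i < e) u 0 i *: x i) /\
      cancel (fun u : 'rV[K]_e => \sum_(i < e) u 0 i *: x i) f.
  move=> Hx; have [f Hf] := choice Hx; exists f; split => [v|u]; first by have [] := Hf v.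
  by have [_] := Hf (\sum_(i < e) u 0 i *: x i); apply.
have [f [fK Kf]] := bas r b Hb; have [g [gK Kg]] := bas d c Hc.
have bij : bijective (fun u : 'rV[K]_r => g (\sum_(i < r) u 0 i *: b i)).
  apply: (@Bijective _ _ _ (fun u : 'rV[K]_d => f (\sum_(i < d) u 0 i *: c i))) => u.
    by rewrite gK Kf.
  by rewrite fK Kg.
have : #|{: 'rV[K]_r}| = #|{: 'rV[K]_d}| by exact: bij_eq_card bij.
by rewrite !card_mx !mul1n => /eqP; rewrite eqn_exp2l ?card_finRing_gt1 // => /eqP.
Qed.

Lemma has_dim_coords (K : fieldType) (V : lmodType K) (d : nat) (f : V -> 'rV[K]_d)
    (b : 'I_d -> V) :
  {morph f : u v / u - v} -> (forall a u, f (a *: u) = a *: f u) ->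
  (forall i, f (b i) = delta_mx 0 i) -> (forall v, f v = 0 -> v = 0) ->
  has_dim V d.
Proof.
move=> fB fZ fb finj; exists b => v.
have f0 : f 0 = 0 by rewrite -(subrr 0) fB subrr.
have fD u w : f (u + w) = f u + f w.
  have fN x : f (- x) = - f x by rewrite -[- x]add0r fB f0 sub0r.
  by rewrite -{1}[w]opprK fB fN opprK.
have fsum (c : 'rV[K]_d) : f (\sum_(i < d) c 0 i *: b i) = c.
  rewrite [RHS]row_sum_delta (big_morph f fD f0).
  by apply: eq_bigr => i _; rewrite fZ fb.
exists (f v); split => [|c ->]; last exact: fsum.
by apply/eqP; rewrite -subr_eq0; apply/eqP/finj; rewrite fB fsum subrr.
Qed.

Section TensorLift.
Variables (S : zmodType) (A : pzRingType) (W : lmodType A) (h : S -> W).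
Hypothesis hD : {morph h : s t / s + t}.

(** The map induced on the tensor product by the universal property, computed on a chosen
    representative. *)
Definition tensor_lift (u : tensor S A) : W :=
  fglift (fun sa : S * A => (sa.2 *: h sa.1 : zmodule W)) (repr u).

Let free_lift := fglift (fun sa : S * A => (sa.2 *: h sa.1 : zmodule W)).

Let free_liftB : {morph free_lift : x y / x - y}.
Proof. exact: lift_is_additive. Qed.

Let free_lift0 : free_lift 0 = 0.
Proof. by rewrite -[X in free_lift X](subrr 0) free_liftB subrr. Qed.

Let free_liftD : {morph free_lift : x y / x + y}.
Proof.
move=> x y; have N z : free_lift (- z) = - free_lift z.
  by rewrite -[X in free_lift X]add0r free_liftB free_lift0 add0r.
by rewrite -{1}[y]opprK free_liftB N opprK.
Qed.

Let free_liftU s a : free_lift << (s, a) >> = a *: h s.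
Proof. by rewrite /free_lift liftU scale1r. Qed.

Let free_lift_rel x : tensor_rel x -> free_lift x = 0.
Proof.
elim=> [//|y z _ Hy _ Hz|s t a|s a b].
- by rewrite free_liftB Hy Hz subrr.
- by rewrite free_liftB free_liftD !free_liftU hD scalerDr subrr.
- by rewrite free_liftB free_liftD !free_liftU scalerDl subrr.
Qed.

Let tensor_lift_pi x : tensor_lift (\pi_(tensor S A) x) = free_lift x.
Proof.
apply/eqP; rewrite -subr_eq0 -free_liftB; apply/eqP/free_lift_rel/tensor_eqP.
by rewrite reprK.
Qed.

Lemma tensor_lift_tens s a : tensor_lift (tens s a) = a *: h s.
Proof. by rewrite tensor_lift_pi free_liftU. Qed.

Lemma tensor_liftB : {morph tensor_lift : u v / u - v}.
Proof.
move=> u v; rewrite -[u]reprK -[v]reprK -pi_tensorB.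
by rewrite !tensor_lift_pi free_liftB.
Qed.

Lemma tensor_liftZ a u : tensor_lift (a *: u) = a *: tensor_lift u.
Proof.
have L0 : tensor_lift 0 = 0 by rewrite -[X in tensor_lift X](subrr 0) tensor_liftB subrr.
elim/tensor_ind: u => [|u v IHu IHv|s b]; first by rewrite scaler0 L0 scaler0.
  by rewrite scalerBr !tensor_liftB IHu IHv scalerBr.
by rewrite [_ *: _]tensor_scale_tens !tensor_lift_tens scalerA.
Qed.
End TensorLift.

Lemma Fp_intr_eq0 (p : nat) (m : int) : prime p -> (m%:~R == 0 :> 'F_p) = (p %| m)%Z.
Proof.
move=> pp; have ch : p \in [pchar 'F_p] by exact: pchar_Fp.
rewrite /dvdz; case: m => m; first by rewrite -pmulrn -(dvdn_pcharf ch).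
by rewrite NegzE mulrNz oppr_eq0 -pmulrn -(dvdn_pcharf ch).
Qed.

Lemma laplacian_sym (n : nat) (g : {set {set 'I_n}}) i j : laplacian g i j = laplacian g j i.
Proof.
rewrite !mxE eq_sym; case: eqP => [->//|_].
by rewrite /adj eq_sym finset.setUC.
Qed.

Lemma laplacian_row_sum (n : nat) (g : {set {set 'I_n}}) i : \sum_j laplacian g i j = 0.
Proof.
have := laplacian_sum0 g (delta_mx i 0); rewrite inE => /eqP z.
rewrite -[RHS]z; apply: eq_bigr => j _; by rewrite -colE [RHS]mxE laplacian_sym.
Qed.

Definition reduced_laplacian (p N : nat) (g : {set {set 'I_N.+1}}) : 'M['F_p]_N :=
  \matrix_(i, j) (laplacian g (lift ord0 i) (lift ord0 j))%:~R.

Lemma reduced_laplacian_tr (p N : nat) (g : {set {set 'I_N.+1}}) :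
  (reduced_laplacian p g)^T = reduced_laplacian p g.
Proof. by apply/matrixP => i j; rewrite mxE mxE [RHS]mxE laplacian_sym. Qed.

Section SandpileRank.
Variables (p N : nat) (g : {set {set 'I_N.+1}}).
Hypothesis p_prime : prime p.

Local Notation L := (laplacian g).
Local Notation M := (reduced_laplacian p g).
Local Notation S := (sandpile g).

(** A vector of sum zero is determined by its coordinates other than [ord0], so on the lattice
    dropping that one loses nothing. *)
Definition reduction (v : 'cV[int]_N.+1) : 'rV['F_p]_N := \row_i (v (lift ord0 i) 0)%:~R.

Lemma reductionD : {morph reduction : u v / u + v}.
Proof. by move=> u v; apply/rowP => i; rewrite !mxE rmorphD. Qed.

Lemma reductionB : {morph reduction : u v / u - v}.
Proof. by move=> u v; apply/rowP => i; rewrite !mxE rmorphB. Qed.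

(** The rows of [L] sum to 0, so subtracting [x 0 0] from every coordinate changes nothing and
    eliminates vertex [ord0]. Symmetry lets [M] act from the right. *)
Lemma reduction_laplacian (x : 'cV[int]_N.+1) :
  reduction (L *m x) = (\row_j (x (lift ord0 j) 0 - x 0 0)%:~R) *m M.
Proof.
apply/rowP => i; rewrite !mxE big_ord_recl rmorphD /=.
have := laplacian_row_sum g (lift ord0 i); rewrite big_ord_recl => /eqP.
rewrite addr_eq0 => /eqP ->; rewrite mulNr rmorphN mulr_suml !rmorph_sum /=.
rewrite -sumrN -big_split /=; apply: eq_bigr => j _.
rewrite [X in _ = X * _]mxE [X in _ = _ * X]mxE laplacian_sym.
by rewrite !rmorphM rmorphB /=; ring.
Qed.

Definition sum0_ext (y : 'I_N -> int) : 'cV[int]_N.+1 :=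
  \col_i if unlift ord0 i is Some j then y j else - \sum_j y j.

Lemma sum0_ext_lift y i : sum0_ext y (lift ord0 i) 0 = y i.
Proof. by rewrite mxE liftK. Qed.

Lemma sum0_extP y : sum0_ext y \in @sum0 N.+1.
Proof.
rewrite inE big_ord_recl mxE unlift_none addrC subr_eq0; apply/eqP.
by apply: eq_bigr => i _; rewrite sum0_ext_lift.
Qed.

Lemma sum0_eq (u v : 'cV[int]_N.+1) : u \in @sum0 N.+1 -> v \in @sum0 N.+1 ->
  (forall i, u (lift ord0 i) 0 = v (lift ord0 i) 0) -> u = v.
Proof.
rewrite !inE !big_ord_recl !addr_eq0 => /eqP u0 /eqP v0 uv.
apply/colP => i; case: (unliftP ord0 i) => [j|] ->; first exact: uv.
by rewrite u0 v0; congr (- _); apply: eq_bigr => j _; exact: uv.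
Qed.

(** Lifting the coefficients of the row combination to integers gives [x]. The coordinates of
    [v - L *m x] other than [ord0] are then divisible by [p], and their quotients are [y]. *)
Lemma sub_reduced_laplacian (v : 'cV[int]_N.+1) :
  v \in @sum0 N.+1 -> (reduction v <= M)%MS ->
  exists x y, v = L *m x + sum0_ext y *+ p.
Proof.
move=> v0 /submxP[z vz].
pose x : 'cV[int]_N.+1 := \col_i if unlift ord0 i is Some j then (val (z 0 j))%:Z else 0.
have xv : reduction (v - L *m x) = 0.
  rewrite reductionB reduction_laplacian vz -mulmxBl (_ : _ - _ = 0) ?mul0mx //.
  apply/rowP => j; rewrite !mxE liftK unlift_none subr0 -pmulrn natr_Zp.
  by rewrite subrr.
pose y i := divz ((v - L *m x) (lift ord0 i) 0) p.
exists x, y; apply/eqP; rewrite addrC -subr_eq; apply/eqP.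
apply: sum0_eq => [||i].
- by apply: rpredB => //; exact: laplacian_sum0.
- by apply: rpredMn; exact: sum0_extP.
- rewrite [RHS]mulmxnE sum0_ext_lift /y -mulr_natr natz divzK //.
  have /rowP/(_ i) := xv; rewrite !mxE => /eqP; rewrite Fp_intr_eq0 //.
Qed.

Let val_B (u v : sum0_lattice N.+1) : sum0_val (u - v) = sum0_val u - sum0_val v.
Proof. exact: (raddfB (\val : sum0_lattice N.+1 -> 'cV[int]_N.+1)). Qed.

Let val_D (u v : sum0_lattice N.+1) : sum0_val (u + v) = sum0_val u + sum0_val v.
Proof. exact: (raddfD (\val : sum0_lattice N.+1 -> 'cV[int]_N.+1)). Qed.

Let val_Mn (u : sum0_lattice N.+1) k : sum0_val (u *+ k) = sum0_val u *+ k.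
Proof. exact: (raddfMn (\val : sum0_lattice N.+1 -> 'cV[int]_N.+1)). Qed.

Let pi_S : sum0_lattice N.+1 -> S := \pi_(sandpile g).

Let pi_S_D : {morph pi_S : u v / u + v}.
Proof. exact: Quotient.pi_add. Qed.

Let pi_S_eq u v : pi_S u = pi_S v <-> exists x, sum0_val (u - v) = L *m x.
Proof.
split=> [/eqP|H]; first by rewrite -Quotient.idealrBE /in_mem /= => /asboolP.
by apply/eqP; rewrite -Quotient.idealrBE /in_mem /=; apply/asboolP.
Qed.

Local Notation d := (\rank (cokermx M)).
(** [Kb] has full column rank and its left kernel is the row space of [M], so multiplying by it
    realizes the quotient by that space as rows of length [d]. *)
Let Kb := col_base (cokermx M).

Let KbP (u : 'rV_N) : (u *m Kb == 0) = (u <= M)%MS.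
Proof.
rewrite submxE -[X in _ = (u *m X == 0)](mulmx_base (cokermx M)) mulmxA.
apply/eqP/eqP => [->|H]; first by rewrite mul0mx.
by apply: (row_free_inj (row_base_free (cokermx M))); rewrite mul0mx.
Qed.

Let h (s : S) : 'rV['F_p]_d := reduction (sum0_val (repr s)) *m Kb.

Let h_pi v : h (pi_S v) = reduction (sum0_val v) *m Kb.
Proof.
apply/eqP; rewrite -subr_eq0 -mulmxBl KbP -reductionB.
have /pi_S_eq[x] : pi_S (repr (pi_S v)) = pi_S v by rewrite /pi_S reprK.
by rewrite val_B => ->; rewrite reduction_laplacian submxMl.
Qed.

Let hD : {morph h : s t / s + t}.
Proof.
move=> s t; rewrite -[s]reprK -[t]reprK -/(pi_S _) -/(pi_S (repr t)) -pi_S_D !h_pi.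
by rewrite val_D reductionD mulmxDl.
Qed.

Let tens_0l (s : S) : tens s (0 : 'F_p) = 0.
Proof. by apply: (@addrI _ (tens s 0)); rewrite -tens_Dr !addr0. Qed.

Let tens_0r (a : 'F_p) : tens (0 : S) a = 0.
Proof. by apply: (@addrI _ (tens 0 a)); rewrite -tens_Dl !addr0. Qed.

Let tens_Mn (s : S) (a : 'F_p) k : tens (s *+ k) a = tens s (a *+ k).
Proof.
elim: k => [|k IH]; first by rewrite !mulr0n tens_0l tens_0r.
by rewrite !mulrS tens_Dl tens_Dr IH.
Qed.

(** Vanishing of [h s] makes [s] equal to [p] times a class; the factor [p] moves across the tensor
    sign onto [a], where it is 0. *)
Let tens_eq0 s a : h s = 0 -> tens s (a : 'F_p) = 0.
Proof.
move=> hs0; have : (reduction (sum0_val (repr s)) <= M)%MS by rewrite -KbP; apply/eqP.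
move=> /(sub_reduced_laplacian (valP (repr s)))[x [y E]].
pose Y := Sum0 (sum0_extP y).
have -> : s = pi_S Y *+ p.
  rewrite -[LHS]reprK -/(pi_S _).
  have -> : pi_S Y *+ p = pi_S (Y *+ p).
    elim: (p) => [|k IH].
      by rewrite !mulr0n; apply: (@addrI _ (pi_S 0)); rewrite -pi_S_D !addr0.
    by rewrite !mulrS pi_S_D IH.
  by apply/pi_S_eq; exists x; rewrite val_B val_Mn E /= addrK.
rewrite tens_Mn -[a *+ p]mulr_natr pchar_Fp_0 // mulr0; exact: tens_0l.
Qed.

(** The lift [f] of [h] gives coordinates, and the basis consists of the tensors [tens (z i) 1] with
    [h (z i)] the unit rows. So the dimension is the corank of [M]. *)
Lemma has_dim_sandpile_tensor (r : nat) :
  has_dim (tensor S 'F_p) r <-> (\rank M + r = N)%N.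
Proof.
pose f := tensor_lift (A := 'F_p) h.
have fT s a : f (tens s a) = a *: h s by exact: tensor_lift_tens.
have [z hz] : exists z : 'I_d -> S, forall i, h (z i) = delta_mx 0 i.
  pose P := pinvmx Kb.
  have PK : P *m Kb = 1%:M by apply: mulVpmx; exact: col_base_full.
  exists (fun i => pi_S (Sum0 (sum0_extP (fun j => (val (P i j))%:Z)))) => i.
  rewrite h_pi (_ : reduction _ = row i P); last first.
    by apply/rowP => j; rewrite mxE sum0_ext_lift -pmulrn natr_Zp [RHS]mxE.
  by rewrite -row_mul PK row1.
have h0 : h 0 = 0 by apply: (@addrI _ (h 0)); rewrite -hD !addr0.
have hMn s k : h (s *+ k) = h s *+ k.
  by elim: k => [|k IH]; rewrite ?mulr0n // !mulrS hD IH.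
have f0 : f 0 = 0 by rewrite /f -(subrr 0) tensor_liftB // subrr.
(* Every tensor is the combination given by its own coordinates, which also yields injectivity of
   [f]. *)
have gen v : v = \sum_(i < d) f v 0 i *: tens (z i) 1.
  elim/tensor_ind: v => [|u v IHu IHv|s a].
  - by rewrite f0 big1 // => i _; rewrite mxE scale0r.
  - rewrite {1}IHu {1}IHv -sumrB; apply: eq_bigr => i _.
    by rewrite /f tensor_liftB // !mxE scalerBl.
  (* An integer combination of the [z i] with the same value under [h] as [s], so [tens_eq0] applies
     to [s - s']. *)
  - pose s' := \sum_(i < d) z i *+ val (h s 0 i).
    have hs' : h s' = h s.
      rewrite (big_morph h hD h0) [RHS]row_sum_delta; apply: eq_bigr => i _.
      by rewrite hMn hz -scaler_nat natr_Zp.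
    have hN t : h (- t) = - h t by apply: (@addrI _ (h t)); rewrite -hD !subrr h0.
    have E : tens s a = tens s' a.
      apply/eqP; rewrite -subr_eq0; apply/eqP.
      have -> : tens s a - tens s' a = tens (s - s') a.
        by apply/eqP; rewrite subr_eq -tens_Dl subrK.
      by apply: tens_eq0; rewrite hD hN hs' subrr.
    rewrite {1}E (big_morph (fun t => tens t a) (fun x y => tens_Dl x y a) (tens_0r a)).
    apply: eq_bigr => i _; rewrite tens_Mn fT [X in X *: _]mxE [_ *: _]tensor_scale_tens mulr1.
    by rewrite -mulr_natr natr_Zp.
have D : has_dim (tensor S 'F_p) d.
  apply: (@has_dim_coords _ _ _ f (fun i => tens (z i) 1)).
  - exact: tensor_liftB.
  - by move=> a u; exact: tensor_liftZ.
  - by move=> i; rewrite fT hz scale1r.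
  - by move=> v fv; rewrite (gen v) big1 // => i _; rewrite fv mxE scale0r.
have rM := rank_leq_row M.
have dE : d = (N - \rank M)%N by rewrite mxrank_coker.
split=> [H|H]; first by rewrite (has_dim_inj H D) dE subnKC.
have -> : r = d by rewrite dE; lia.
exact: D.
Qed.
End SandpileRank.

Local Close Scope quotient_scope.

(** * Moments of the random graph *)

Lemma sum_offdiag (V : nmodType) (n : nat) (F : 'I_n -> 'I_n -> V) :
  (forall i, F i i = 0) ->
  \sum_i \sum_j F i j = \sum_(ij : 'I_n * 'I_n | (ij.1 < ij.2)%N) (F ij.1 ij.2 + F ij.2 ij.1).
Proof.
move=> F0; pose sw (ij : 'I_n * 'I_n) := (ij.2, ij.1).
have sw_inj : injective sw by move=> [i j] [i' j'] [-> ->].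
rewrite big_split /= [X in _ = _ + X](reindex_inj sw_inj) /=.
rewrite pair_big /= (bigID (fun ij : 'I_n * 'I_n => (ij.1 < ij.2)%N)) /=; congr (_ + _).
rewrite (bigID (fun ij : 'I_n * 'I_n => (ij.2 < ij.1)%N)) /= [X in _ + X]big1 ?addr0.
  by apply: eq_bigl => -[i j] /=; case: ltngtP.
by move=> [i j] /=; case: ltngtP => // /val_inj->.
Qed.

(** Independence of the edges: the mean of a product over the edges factors. Edges are indexed by
    the ordered pairs [i < j]. *)
Lemma sum_graphs (K : comPzRingType) (n : nat) (a b : K) (x : 'I_n * 'I_n -> K) :
  \sum_(g in powerset (pairs n)) (\prod_(e in pairs n) (if e \in g then a else b)) *
     \prod_(ij : 'I_n * 'I_n | (ij.1 < ij.2)%N) (if [set ij.1; ij.2] \in g then x ij else 1)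
  = \prod_(ij : 'I_n * 'I_n | (ij.1 < ij.2)%N) (b + a * x ij).
Proof.
pose D := [set ij : 'I_n * 'I_n | (ij.1 < ij.2)%N].
pose h (ij : 'I_n * 'I_n) := [set ij.1; ij.2].
have hinj : {in D &, injective h}.
  move=> [i j] [i' j']; rewrite !inE /h /= => ij ij' /setP e.
  have := e i; have := e j; have := e i'; have := e j'; rewrite !inE !eqxx /= ?orbT -!val_eqE /=.
  by move=> e1 e2 e3 e4; congr (_, _); apply/val_inj => /=; lia.
have pE : pairs n = h @: D.
  apply/setP => e; rewrite inE; apply/cards2P/imsetP => [[i [j [ij ->]]]|[[i j] + ->]]; last first.
    by rewrite inE /= => ij; exists i, j; split => //; rewrite neq_ltn ij.
  case: (ltngtP i j) => [lt|gt|/val_inj e0]; last by rewrite e0 eqxx in ij.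
    by exists (i, j); rewrite ?inE.
  by exists (j, i); rewrite ?inE // /h /= setUC.
pose y e := if [pick ij | (ij \in D) && (h ij == e)] is Some ij then x ij else 1.
have yh ij : ij \in D -> y (h ij) = x ij.
  move=> ijD; rewrite /y; case: pickP => [ij' /andP[ij'D /eqP/hinj->]//|/(_ ij)].
  by rewrite ijD eqxx.
have reidx (F : {set 'I_n} -> K) :
    \prod_(ij : 'I_n * 'I_n | (ij.1 < ij.2)%N) F (h ij) = \prod_(e in pairs n) F e.
  by rewrite pE big_imset //; apply: eq_bigl => ij; rewrite inE.
transitivity (\prod_(e in pairs n) (b + a * y e)); last first.
  rewrite -reidx; apply: eq_bigr => ij ijD; rewrite yh ?inE //.
transitivity (\sum_(g in powerset (pairs n)) \prod_(e in pairs n) (if e \in g then a * y e else b)).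
  apply: eq_bigr => g _.
  rewrite [X in _ * X](_ : _ = \prod_(e in pairs n) (if e \in g then y e else 1)); last first.
    by rewrite -reidx; apply: eq_bigr => ij ijD; rewrite yh ?inE.
  by rewrite -big_split; apply: eq_bigr => e _ /=; case: ifP; rewrite ?mulr1.
(* The values 0 and 1 outside [pairs n] make the expansion over all families of vertex sets retain
   only the graphs. *)
pose F1 e := if e \in pairs n then a * y e else 0.
pose F2 e := if e \in pairs n then b else 1.
transitivity (\prod_e (F1 e + F2 e)); last first.
  rewrite [RHS]big_mkcond; apply: eq_bigr => e _; rewrite /F1 /F2.
  by case: ifP; rewrite ?add0r // addrC.
rewrite bigA_distr big_mkcond; apply: eq_bigr => g _; rewrite inE.
have [gp|] := boolP (g \subset pairs n).
  rewrite big_mkcond; apply: eq_bigr => e _; rewrite /F1 /F2.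
  by case: (boolP (e \in g)) => eg; [rewrite (subsetP gp _ eg)|].
move=> /subsetPn[e eg ep]; rewrite (bigD1 e) //= eg /F1 (negbTE ep) mul0r //.
Qed.

Section RootedExtension.
Variables (F : finFieldType) (k : nat).
Local Notation X := ('rV[F]_k * 'rV[F]_k)%type.

(* Vertex [ord0], whose row and column the reduced Laplacian drops, goes to 0. *)
Definition rooted_ext (N : nat) (D V : 'M[F]_(N, k)) : {ffun 'I_N.+1 -> X} :=
  [ffun i => if unlift ord0 i is Some j then (row j D, row j V) else (0, 0)].

Definition hyperbolic_form (x y : X) : F := ((x.1 - y.1) *m (x.2 - y.2)^T) 0 0.

Lemma hyperbolic_relE (x y : X) : hyperbolic_rel x y = (hyperbolic_form x y == 0).
Proof.
rewrite /hyperbolic_form; apply/eqP/eqP => [->|h]; first by rewrite mxE.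
by apply/matrixP => i j; rewrite !ord1 h mxE.
Qed.

Lemma rooted_ext_lift N (D V : 'M[F]_(N, k)) j :
  rooted_ext D V (lift ord0 j) = (row j D, row j V).
Proof. by rewrite ffunE liftK. Qed.

Lemma rooted_ext0 N (D V : 'M[F]_(N, k)) : rooted_ext D V ord0 = (0, 0).
Proof. by rewrite ffunE unlift_none. Qed.

Lemma rooted_ext_inj N : injective (fun DV : 'M[F]_(N, k) * 'M[F]_(N, k) => rooted_ext DV.1 DV.2).
Proof.
move=> [D V] [D' V'] /= /ffunP e; congr (_, _); apply/row_matrixP => i.
  by have := e (lift ord0 i); rewrite !rooted_ext_lift => -[].
by have := e (lift ord0 i); rewrite !rooted_ext_lift => -[].
Qed.

Definition bil (x y : X) : F := (x.1 *m y.2^T) 0 0.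

Lemma hyperbolic_formE x y : hyperbolic_form x y = bil x x - bil x y - bil y x + bil y y.
Proof.
rewrite /hyperbolic_form /bil linearB /= mulmxBr !mulmxBl !mxE; ring.
Qed.

Lemma bil_ext N (D V : 'M[F]_(N, k)) i j :
  bil (rooted_ext D V (lift ord0 i)) (rooted_ext D V (lift ord0 j)) = (D *m V^T) i j.
Proof. by rewrite !rooted_ext_lift /bil !mxE; apply: eq_bigr => l _; rewrite !mxE. Qed.

Lemma bil_ext0l N (D V : 'M[F]_(N, k)) x : bil (rooted_ext D V ord0) x = 0.
Proof. by rewrite rooted_ext0 /bil mul0mx mxE. Qed.

Lemma bil_ext0r N (D V : 'M[F]_(N, k)) x : bil x (rooted_ext D V ord0) = 0.
Proof. by rewrite rooted_ext0 /bil trmx0 mulmx0 mxE. Qed.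

(** Compatibility with the root makes the diagonal of [D *m V^T] vanish; compatibility among the
    other vertices then amounts to antisymmetry. *)
Lemma conflicts_rooted_ext N (D V : 'M[F]_(N, k)) :
  (conflicts (@hyperbolic_rel F k) (rooted_ext D V) == set0) = alternating (D *m V^T).
Proof.
apply/eqP/andP => [/setP e|[/forallP d /eqP s]].
  have Q0 i j : hyperbolic_form (rooted_ext D V i) (rooted_ext D V j) = 0.
    by have := e (i, j); rewrite !inE /= hyperbolic_relE => /negbFE/eqP.
  have d i : (D *m V^T) i i = 0.
    have := Q0 (lift ord0 i) ord0; rewrite hyperbolic_formE bil_ext !bil_ext0r !bil_ext0l.
    by rewrite !subr0 addr0.
  split; first by apply/forallP => i; rewrite d.
  apply/eqP/matrixP => i j; have := Q0 (lift ord0 i) (lift ord0 j).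
  rewrite hyperbolic_formE !bil_ext !d sub0r addr0 => /eqP; rewrite subr_eq0 => /eqP e'.
  by rewrite [LHS]mxE [RHS]mxE e'.
have sij i j : (D *m V^T) j i = - (D *m V^T) i j.
  by have := congr1 (fun B : 'M_N => B i j) s; rewrite [X in X = _]mxE [X in _ = X]mxE.
apply/setP => -[i j]; rewrite !inE /= hyperbolic_relE; apply/negbTE; rewrite negbK.
rewrite hyperbolic_formE.
case: (unliftP ord0 i) => [i' ->|->]; case: (unliftP ord0 j) => [j' ->|->];
  rewrite ?bil_ext ?bil_ext0l ?bil_ext0r ?(eqP (d _)) ?(sij i' j') ?subrr ?addr0 ?subr0 //.
by rewrite sub0r opprK addNr.
Qed.
End RootedExtension.

(** The root goes to 0, so the full Laplacian may replace the reduced one; the terms of [(i, j)] and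
    [(j, i)] then combine into the negated quadratic form. *)
Lemma trace_reduced_laplacian (p N k : nat) (g : {set {set 'I_N.+1}}) (D V : 'M['F_p]_(N, k)) :
  \tr (D^T *m (reduced_laplacian p g *m V)) =
  \sum_(ij : 'I_N.+1 * 'I_N.+1 | (ij.1 < ij.2)%N)
    (adj g ij.1 ij.2)%:R * - hyperbolic_form (rooted_ext D V ij.1) (rooted_ext D V ij.2).
Proof.
pose w := rooted_ext D V; pose b i j := bil (w i) (w j).
have -> : \tr (D^T *m (reduced_laplacian p g *m V)) =
    \sum_i \sum_j (laplacian g i j)%:~R * b i j.
  rewrite trace_swap /mxtrace [RHS]big_ord_recl [X in _ = X + _]big1 ?add0r => [|j _]; last first.
    by rewrite /b /w bil_ext0l mulr0.
  apply: eq_bigr => i _; rewrite [RHS]big_ord_recl /b /w bil_ext0r mulr0 add0r mxE.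
  by apply: eq_bigr => j _; rewrite bil_ext [X in X * _]mxE [X in _ * X]mxE.
have adjC i j : adj g i j = adj g j i by rewrite /adj eq_sym setUC.
(* Row sums of the Laplacian are 0, so [b i i] can be subtracted along row [i]; this removes the
   degrees on the diagonal. *)
transitivity (\sum_i \sum_j (adj g i j)%:R * (b i j - b i i)).
  apply: eq_bigr => i _.
  have -> : \sum_j (laplacian g i j)%:~R * b i j = \sum_j (laplacian g i j)%:~R * (b i j - b i i).
    under [RHS]eq_bigr do rewrite mulrBr.
    rewrite sumrB -mulr_suml -(rmorph_sum intr) /= laplacian_row_sum.
    by rewrite mul0r subr0.
  apply: eq_bigr => j _; rewrite mxE; case: eqP => [->|_]; first by rewrite subrr !mulr0.
  by [].
rewrite sum_offdiag => [|i]; last by rewrite /adj eqxx mul0r.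
apply: eq_bigr => -[i j] _ /=; rewrite hyperbolic_formE -/w (adjC j i) -mulrDr.
congr (_ * _); rewrite /b; ring.
Qed.

(** Equality in the triangle inequality would align [b * z] with [a] and force [z = 1]. *)
Lemma norm_unit_mix_lt1 (C : numClosedFieldType) (a b z : C) :
  0 < a -> 0 < b -> a + b = 1 -> `|z| = 1 -> z != 1 -> `|a + b * z| < 1.
Proof.
move=> a0 b0 ab z1 zn1.
have le1 : `|a + b * z| <= 1.
  by apply: le_trans (ler_normD _ _) _; rewrite normrM z1 mulr1 !gtr0_norm // ab.
rewrite lt_neqAle le1 andbT; apply: contra zn1 => /eqP e.
have /normCDeq[t /eqP t1 [ta tb]] : `|a + b * z| = `|a| + `|b * z|.
  by rewrite e normrM z1 mulr1 !gtr0_norm // ab.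
have a_neq0 : a != 0 by rewrite gt_eqF.
have b_neq0 : b != 0 by rewrite gt_eqF.
have tE : t = 1 by apply: (mulfI a_neq0); rewrite mulr1 {2}ta gtr0_norm.
apply/eqP/(mulfI b_neq0); rewrite mulr1 tb tE mulr1 normrM z1 mulr1 gtr0_norm //.
Qed.

Lemma normc_real (R : rcfType) (x : R) : `|real_complex R x| = real_complex R `|x|.
Proof. by rewrite normc_def /= expr0n addr0 sqrtr_sqr. Qed.

Section GnqMoments.
Variables (R : realType) (q : R) (p : nat) (psi : 'F_p -> R[i]).
Hypotheses (q_gt0 : 0 < q) (q_lt1 : q < 1) (p_prime : prime p).
Hypotheses (psiD : {morph psi : a b / a + b >-> a * b})
  (psi_eq1 : forall a, (psi a == 1) = (a == 0)) (psi_norm : forall a, `|psi a| = 1).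
Local Notation "x %:Cx" := (real_complex R x) (at level 2).

(** The mean of [psi] at [t] times the indicator of an edge of probability [q]. *)
Definition edge_char (t : 'F_p) : R[i] := (1 - q%:Cx) + q%:Cx * psi t.

Lemma edge_char0 : edge_char 0 = 1.
Proof. by rewrite /edge_char (character0 psi_eq1) mulr1 subrK. Qed.

(** Over the finitely many nonzero [t] the norms have a maximum below 1; [sg] is its square root
    because [conflicts] counts each edge twice. *)
Lemma edge_char_bound : exists2 sg : R, 0 <= sg < 1 &
  forall t, t != 0 -> `|edge_char t| <= (sg ^+ 2)%:Cx.
Proof.
pose nr (z : R[i]) := complex.Re `|z|.
have nrE z : `|z| = (nr z)%:Cx by rewrite /nr normc_def.
pose rho := \big[Num.max/0]_(t : 'F_p | t != 0) nr (edge_char t).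
have rho0 : 0 <= rho by exact: bigmax_ge_id.
have rho1 : rho < 1.
  apply/bigmax_ltP; split => // t t0; rewrite -ltcR -nrE.
  apply: norm_unit_mix_lt1; rewrite ?psi_norm ?psi_eq1 ?subrK //.
    by rewrite subr_gt0 -[1]/(1%:Cx) ltcR.
  by rewrite -[0]/(0%:Cx) ltcR.
exists (Num.sqrt rho).
  by rewrite sqrtr_ge0 /= -[X in _ < X]sqrtr1 ltr_sqrt.
move=> t t0; rewrite sqr_sqrtr // nrE lecR.
exact: (le_bigmax_cond 0 (fun t => nr (edge_char t)) t0).
Qed.

Definition kernel_count (N k : nat) (M : 'M['F_p]_N) : nat :=
  #|[set V : 'M['F_p]_(N, k) | row_full V && (M *m V == 0)]|.

Lemma gnq_character_mean (N k : nat) (D V : 'M['F_p]_(N, k)) :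
  \sum_(g in powerset (pairs N.+1)) (gnq_weight q g)%:Cx *
     psi (\tr (D^T *m (reduced_laplacian p g *m V)))
  = \prod_(ij : 'I_N.+1 * 'I_N.+1 | (ij.1 < ij.2)%N)
      edge_char (- hyperbolic_form (rooted_ext D V ij.1) (rooted_ext D V ij.2)).
Proof.
rewrite /edge_char -sum_graphs; apply: eq_bigr => g _; congr (_ * _).
  rewrite /gnq_weight rmorph_prod; apply: eq_bigr => e _.
  by case: ifP; rewrite // rmorphB rmorph1.
rewrite trace_reduced_laplacian (character_sum psiD psi_eq1); apply: eq_bigr => ij lt.
rewrite /adj (_ : ij.1 != ij.2) /=; last by rewrite -val_eqE neq_ltn lt.
by case: ifP; rewrite ?mul1r // mul0r (character0 psi_eq1).
Qed.

(** Pairs with [D *m V^T] alternating contribute exactly 1 each and make up the subtracted term; any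
    other pair is bounded through the conflicts of its rooted extension. *)
Lemma gnq_moment_bound (sg : R) (N k : nat) : 0 <= sg <= 1 ->
  (forall t, t != 0 -> `|edge_char t| <= (sg ^+ 2)%:Cx) ->
  `|\sum_(g in powerset (pairs N.+1)) gnq_weight q g *
       (kernel_count k (reduced_laplacian p g))%:R * p%:R ^+ (N * k)
    - (\prod_(i < k) (p ^ N - p ^ i) * p ^ 'C(k, 2))%:R|
  <= \sum_(w : {ffun 'I_N.+1 -> 'rV['F_p]_k * 'rV['F_p]_k}
       | conflicts (@hyperbolic_rel _ k) w != set0)
       sg ^+ #|conflicts (@hyperbolic_rel _ k) w|.
Proof.
move=> /andP[sg0 sg1] Hsg; have cF : #|'F_p| = p by exact: card_Fp.
pose Phi (D V : 'M['F_p]_(N, k)) := \prod_(ij : 'I_N.+1 * 'I_N.+1 | (ij.1 < ij.2)%N)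
      edge_char (- hyperbolic_form (rooted_ext D V ij.1) (rooted_ext D V ij.2)).
have E : (\sum_(g in powerset (pairs N.+1)) gnq_weight q g *
       (kernel_count k (reduced_laplacian p g))%:R * p%:R ^+ (N * k))%:Cx
    = \sum_(V : 'M['F_p]_(N, k) | row_full V) \sum_(D : 'M['F_p]_(N, k)) Phi D V.
  rewrite rmorph_sum /=.
  transitivity (\sum_(g in powerset (pairs N.+1))
    \sum_(V : 'M['F_p]_(N, k) | row_full V) \sum_(D : 'M['F_p]_(N, k))
      (gnq_weight q g)%:Cx * psi (\tr (D^T *m (reduced_laplacian p g *m V)))).
    apply: eq_bigr => g _.
    rewrite -mulrA rmorphM rmorphM rmorph_nat rmorphXn rmorph_nat -[X in X%:R ^+ _]cF.
    rewrite (kernel_count_character psiD psi_eq1) mulr_sumr.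
    by apply: eq_bigr => V _; rewrite mulr_sumr.
  rewrite exchange_big /=; apply: eq_bigr => V _; rewrite exchange_big /=.
  by apply: eq_bigr => D _; exact: gnq_character_mean.
have Phi1 D V : alternating (D *m V^T) -> Phi D V = 1.
  rewrite -conflicts_rooted_ext => /eqP/setP c; apply: big1 => ij _.
  have := c ij; rewrite !inE hyperbolic_relE => /negbFE/eqP ->.
  by rewrite oppr0 edge_char0.
have PhiN D V : `|Phi D V| <= (sg ^+ #|conflicts (@hyperbolic_rel _ k) (rooted_ext D V)|)%:Cx.
  set w := rooted_ext D V.
  pose bad ij := ~~ hyperbolic_rel (w ij.1) (w ij.2).
  have cE : #|conflicts (@hyperbolic_rel _ k) w|
     = (\sum_(ij : 'I_N.+1 * 'I_N.+1 | (ij.1 < ij.2)%N) 2 * bad ij)%N.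
    rewrite -sum1_card big_mkcond /=.
    rewrite (eq_bigr (fun ij => nat_of_bool (bad (ij.1, ij.2)))); last first.
      by move=> [i j] _; rewrite inE /bad /=; case: hyperbolic_rel.
    rewrite -(pair_bigA _ (fun i j => nat_of_bool (bad (i, j)))) /=.
    have := @sum_offdiag nat N.+1 (fun i j => nat_of_bool (bad (i, j))); rewrite /= => ->.
      apply: eq_bigr => -[i j] _; rewrite /bad /= [hyperbolic_rel (w j) _]hyperbolic_rel_sym.
      by case: hyperbolic_rel.
    by move=> i; rewrite /bad /= hyperbolic_rel_refl.
  rewrite cE /Phi normr_prod -prodrXr rmorph_prod; apply: ler_prod => ij _.
  rewrite normr_ge0 /= /bad hyperbolic_relE; case: eqP => [->|/eqP nz].
    by rewrite oppr0 edge_char0 normr1 muln0 expr0.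
  by rewrite muln1 Hsg // oppr_eq0.
pose alt V := fun D : 'M['F_p]_(N, k) => alternating (D *m V^T).
have M : \sum_(V : 'M['F_p]_(N, k) | row_full V) \sum_(D | alt V D) Phi D V
   = ((\prod_(i < k) (p ^ N - p ^ i) * p ^ 'C(k, 2))%:R)%:Cx.
  rewrite (eq_bigr (fun=> (p ^ 'C(k, 2))%:R)) => [|V fV].
    rewrite (eq_bigl (mem [set V : 'M['F_p]_(N, k) | row_full V])) => [|V]; last by rewrite /= inE.
    rewrite sumr_const card_row_full rmorph_nat -mulrnA mulnC; congr (_ * _)%:R.
    by apply: eq_bigr => i _; rewrite cF.
  rewrite (eq_bigr (fun=> 1)) => [|D]; last exact: Phi1.
  rewrite (eq_bigl (mem [set D : 'M['F_p]_(N, k) | alternating (D *m V^T)])) => [|D]; last first.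
    by rewrite /= inE.
  by rewrite sumr_const card_alternating_mul // cF.
have S : \sum_(V : 'M['F_p]_(N, k) | row_full V) \sum_(D : 'M['F_p]_(N, k)) Phi D V
   = \sum_(V : 'M['F_p]_(N, k) | row_full V) \sum_(D | alt V D) Phi D V
   + \sum_(V : 'M['F_p]_(N, k) | row_full V) \sum_(D | ~~ alt V D) Phi D V.
  by rewrite -big_split; apply: eq_bigr => V _; rewrite (bigID (alt V)).
rewrite -lecR -normc_real rmorphB /= E -M S addrAC subrr add0r.
apply: le_trans (ler_norm_sum _ _ _) _.
apply: (@le_trans _ _ (\sum_(V : 'M['F_p]_(N, k) | row_full V) \sum_(D | ~~ alt V D)
   (sg ^+ #|conflicts (@hyperbolic_rel _ k) (rooted_ext D V)|)%:Cx)).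
  apply: ler_sum => V _; apply: le_trans (ler_norm_sum _ _ _) _.
  by apply: ler_sum => D _; exact: PhiN.
rewrite [leLHS](_ : _ = (\sum_(V : 'M['F_p]_(N, k) | row_full V) \sum_(D | ~~ alt V D)
   sg ^+ #|conflicts (@hyperbolic_rel _ k) (rooted_ext D V)|)%:Cx); last first.
  by rewrite rmorph_sum; apply: eq_bigr => V _; rewrite rmorph_sum.
rewrite lecR.
pose W := [set DV : 'M['F_p]_(N, k) * 'M['F_p]_(N, k) | row_full DV.2 && ~~ alt DV.2 DV.1].
pose ext (DV : 'M['F_p]_(N, k) * 'M['F_p]_(N, k)) := rooted_ext DV.1 DV.2.
have -> : \sum_(V : 'M['F_p]_(N, k) | row_full V) \sum_(D | ~~ alt V D)
    sg ^+ #|conflicts (@hyperbolic_rel _ k) (rooted_ext D V)|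
  = \sum_(w in ext @: W) sg ^+ #|conflicts (@hyperbolic_rel _ k) w|.
  rewrite big_imset /=; last by move=> x y _ _; exact: rooted_ext_inj.
  pose sw (VD : 'M['F_p]_(N, k) * 'M['F_p]_(N, k)) := (VD.2, VD.1).
  have sw_inj : injective sw by move=> [? ?] [? ?] [-> ->].
  rewrite (reindex_inj sw_inj) /= pair_big_dep /=; apply: eq_bigl => -[V D].
  by rewrite inE.
(* Distinct pairs have distinct rooted extensions, and the maps not of this form only increase the
   bound. *)
rewrite [leRHS](bigID (mem (ext @: W))) /=.
rewrite (eq_bigl (fun w => (conflicts (@hyperbolic_rel _ k) w != set0) && (w \in ext @: W))).
  by rewrite lerDl; apply: sumr_ge0 => w _; rewrite exprn_ge0.
move=> w; apply/idP/andP => [wW|[]//]; split => //; move/imsetP: wW => [[D V]].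
by rewrite inE /= => /andP[_ nalt] ->; rewrite /ext /= conflicts_rooted_ext.
Qed.
End GnqMoments.

Local Open Scope classical_set_scope.
Local Open Scope ring_scope.

(** * From moments to the distribution *)

Lemma prodr_scale (R : comPzRingType) (c : R) (k : nat) (F : 'I_k -> R) :
  \prod_(i < k) (c * F i) = c ^+ k * \prod_(i < k) F i.
Proof. by rewrite big_split /= prodr_const card_ord. Qed.

Section QSeries.
Variables (R : realType) (P : R).
Hypothesis P_ge2 : 2 <= P.

(** For a prime power [P], the number of injective linear maps from dimension [k] to dimension [d]
    over the field with [P] elements. *)
Definition qinj (d k : nat) : R := \prod_(i < k) (P ^+ d - P ^+ i).

Definition qfac (j : nat) : R := \prod_(i < j) (P ^+ i.+1 - 1).

(** With x = 1 / P this is x^j / ((1-x)...(1-x^j)). *)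
Definition qweight (j : nat) : R := P ^+ 'C(j, 2) / qfac j.

Lemma qpow_ge1 i : 1 <= P ^+ i.
Proof. by apply: exprn_ege1; move: P_ge2; lra. Qed.

Lemma qpowS_ge2 i : 2 <= P ^+ i.+1.
Proof. by rewrite exprS; have := qpow_ge1 i; move: P_ge2; nra. Qed.

Lemma qfac_gt0 j : 0 < qfac j.
Proof. by apply: prodr_gt0 => i _; have := qpowS_ge2 i; lra. Qed.

Lemma qfacS j : qfac j.+1 = qfac j * (P ^+ j.+1 - 1).
Proof. by rewrite /qfac big_ord_recr. Qed.

Lemma qweight_gt0 j : 0 < qweight j.
Proof. by rewrite divr_gt0 ?qfac_gt0 // exprn_gt0 //; move: P_ge2; lra. Qed.

Lemma qweightS j : qweight j.+1 = qweight j * (P ^+ j / (P ^+ j.+1 - 1)).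
Proof.
rewrite /qweight qfacS binS bin1 exprD invfM; ring.
Qed.

Lemma qweightS_le j : qweight j.+2 <= qweight j.+1 * (2 / 3).
Proof.
rewrite qweightS ler_pM2l ?qweight_gt0 //.
have h := qpowS_ge2 j.
rewrite ler_pdivrMr ?[P ^+ j.+2]exprS; last by move: P_ge2; nra.
by move: P_ge2; nra.
Qed.

(** From index 1 on the ratio of consecutive terms is at most 2/3, and [3 / 2] makes the bound start
    at [qweight 1 <= 1]. *)
Lemma qweight_le j : qweight j <= 3 / 2 * (2 / 3) ^+ j.
Proof.
have u0 : qweight 0 = 1 by rewrite /qweight /qfac big_ord0 divr1.
case: j => [|j]; first by rewrite u0; lra.
have -> : 3 / 2 * (2 / 3) ^+ j.+1 = (2 / 3) ^+ j :> R.
  by rewrite exprS mulrA [_ * (2/3)](_ : _ = 1) ?mul1r //; field.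
elim: j => [|j IH].
  rewrite qweightS u0 !expr0 expr1 mul1r div1r invf_le1; move: P_ge2; lra.
by rewrite exprSr (le_trans (qweightS_le _)) // ler_wpM2r //; lra.
Qed.

(* Summation by telescoping of the q-binomial theorem; for [y = P ^+ m] the
   alternating partial sums are the q-analogue of Bonferroni's inequalities. *)
Lemma qsum_partial (y : R) (J : nat) :
  \sum_(j < J.+1) (-1) ^+ j * (\prod_(i < j) (y - P ^+ i) / qfac j)
  = (-1) ^+ J * (\prod_(i < J) (y - P ^+ i.+1) / qfac J).
Proof.
elim: J => [|J IH]; first by rewrite big_ord_recl !big_ord0 addr0 expr0.
rewrite big_ord_recr /= IH big_ord_recl /= expr0 [in RHS]big_ord_recr /= qfacS.
rewrite exprSr.
have h0 := qfac_gt0 J; have h1 := qpowS_ge2 J.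
by field; apply/andP; split; apply: lt0r_neq0 => //; lra.
Qed.

Lemma qinj_pow_ge0 (m k : nat) : 0 <= qinj m k.
Proof.
have [mk|km] := ltnP m k.
  by rewrite /qinj (bigD1 (Ordinal mk)) //= subrr mul0r.
apply: prodr_ge0 => i _; rewrite subr_ge0 ler_weXn2l //; first by move: P_ge2; lra.
by rewrite (leq_trans _ km) // ltnW.
Qed.

(** For [m = 0] the partial sum is exactly 1. For [m > 0] its closed form vanishes if [m <= J];
    otherwise the bound exceeds it by the factor (P^m - 1) / (P^(J+1) - 1), which is at least 1. *)
Lemma bonferroni0 (m J : nat) :
  `|(m == 0)%:R - \sum_(j < J.+1) (-1) ^+ j * (qinj m j / qfac j)|
  <= qinj m J.+1 / qfac J.+1.
Proof.
rewrite qsum_partial; case: m => [|m] /=.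
  have -> : \prod_(i < J) (P ^+ 0 - P ^+ i.+1) = (-1) ^+ J * qfac J.
    by rewrite /qfac -prodr_scale; apply: eq_bigr => i _; ring.
  rewrite mulrA mulrA -exprMn mulrNN mulr1 expr1n mul1r divff ?gt_eqF ?qfac_gt0 //.
  by rewrite subrr normr0 divr_ge0 ?qinj_pow_ge0 // ltW // qfac_gt0.
rewrite sub0r normrN normrM normrX normrN1 expr1n mul1r.
rewrite qfacS /qinj big_ord_recl /= expr0.
set T := \prod_(i < J) _.
have [mJ|Jm] := ltnP m J.
  by rewrite /T (bigD1 (Ordinal mJ)) //= subrr !(mul0r, mulr0) normr0.
have T0 : 0 <= T.
  apply: prodr_ge0 => i _; rewrite subr_ge0 ler_weXn2l //.
    by move: P_ge2; lra.
  by rewrite ltnS (leq_trans _ Jm) // ltnW.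
have f0 := qfac_gt0 J; have f1 := qpowS_ge2 J; have f2 := qpowS_ge2 m.
rewrite ger0_norm ?divr_ge0 ?(ltW f0) //.
have -> : (P ^+ m.+1 - 1) * T / (qfac J * (P ^+ J.+1 - 1))
   = T / qfac J * ((P ^+ m.+1 - 1) / (P ^+ J.+1 - 1)).
  by field; apply/andP; split; apply: lt0r_neq0 => //; lra.
rewrite ler_peMr ?divr_ge0 ?(ltW f0) // ler_pdivlMr; last by lra.
by rewrite mul1r lerD2r ler_weXn2l //; move: P_ge2; lra.
Qed.

Lemma qinj_split (r m j : nat) :
  qinj (r + m) (r + j) = qinj (r + m) r * (P ^+ (r * j) * qinj m j).
Proof.
rewrite /qinj big_split_ord /= ; congr (_ * _).
rewrite exprM -prodr_scale.
by apply: eq_bigr => i _; rewrite !exprD mulrBr.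
Qed.

Lemma qinjnn j : qinj j j = P ^+ 'C(j, 2) * qfac j.
Proof.
elim: j => [|j IH]; first by rewrite /qinj /qfac !big_ord0 mulr1.
rewrite /qinj big_ord_recl /= expr0 qfacS binS bin1 exprD.
have -> : \prod_(i < j) (P ^+ j.+1 - P ^+ (bump 0 i)) = P ^+ j * qinj j j.
  rewrite /qinj -prodr_scale.
  by apply: eq_bigr => i _; rewrite /bump /= add1n !exprS mulrBr.
by rewrite IH; ring.
Qed.

(** For [d < r] everything vanishes. Otherwise the Gaussian binomial [qinj d r / qinj r r] factors
    out and leaves the case [r = 0] at [d - r]. *)
Lemma bonferroni (d r J : nat) :
  `|(d == r)%:R - \sum_(j < J.+1)
      (-1) ^+ j * (qinj d (r + j) / (P ^+ (r * j) * qfac j * qinj r r))|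
  <= qinj d (r + J.+1) / (P ^+ (r * J.+1) * qfac J.+1 * qinj r r).
Proof.
have Pn0 i : P ^+ i != 0 by rewrite expf_neq0 // gt_eqF //; move: P_ge2; lra.
have fn0 i : qfac i != 0 by rewrite gt_eqF ?qfac_gt0.
have g0 : qinj r r != 0 by rewrite qinjnn mulf_neq0.
have [dr|/subnKC <-] := ltnP d r.
  have z j : qinj d (r + j) = 0.
    have h : (d < r + j)%N by rewrite (leq_trans dr) ?leq_addr.
    by rewrite /qinj (bigD1 (Ordinal h)) //= subrr mul0r.
  rewrite z mul0r big1 ?subr0 => [|j _]; last by rewrite z mul0r mulr0.
  by rewrite (ltn_eqF dr) [false%:R]mulr0n normr0.
set m := (d - r)%N.
have E j : qinj (r + m) (r + j) / (P ^+ (r * j) * qfac j * qinj r r)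
   = qinj (r + m) r / qinj r r * (qinj m j / qfac j).
  by rewrite qinj_split; field; rewrite ?Pn0 ?fn0 ?g0.
have c0 : 0 <= qinj (r + m) r / qinj r r by rewrite divr_ge0 ?qinj_pow_ge0.
rewrite E; under eq_bigr do rewrite E mulrCA.
have -> : (r + m == r)%:R = qinj (r + m) r / qinj r r * (m == 0)%:R.
  rewrite -[X in _ == X]addn0 eqn_add2l; case: m {E c0} => [|m]; last by rewrite mulr0.
  by rewrite addn0 divff // mul1r.
by rewrite -big_distrr -mulrBr normrM ger0_norm // ler_wpM2l // bonferroni0.
Qed.

End QSeries.

(** * Euler's series and the limiting products *)

Section QLimits.
Variables (R : realType) (P : R).
Hypothesis P_ge2 : 2 <= P.

Let x := P^-1.
Let x_gt0 : 0 < x. Proof. by rewrite invr_gt0; move: P_ge2; lra. Qed.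
Let x_lt1 : x < 1. Proof. by rewrite invf_lt1; move: P_ge2; lra. Qed.
Let P_neq0 : P != 0. Proof. by rewrite gt_eqF //; move: P_ge2; lra. Qed.
Let Px i : P ^+ i = (x ^+ i)^-1. Proof. by rewrite exprVn invrK. Qed.
Let xS_lt1 i : x ^+ i.+1 < 1.
Proof. by rewrite exprn_ilt1 //; exact: ltW. Qed.

(** [9 / 2] is the sum of the geometric majorant in [qweight_le]. *)
Lemma qweight_sum_le N : \sum_(j < N) qweight P j <= 9 / 2.
Proof.
suff H : \sum_(j < N) qweight P j <= 9 / 2 * (1 - (2 / 3) ^+ N).
  have : 0 <= (2 / 3 : R) ^+ N by apply: exprn_ge0; lra.
  by move: H; set c := _ ^+ N; lra.
elim: N => [|N IH]; first by rewrite big_ord0 expr0 subrr mulr0.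
rewrite big_ord_recr /= exprSr; have := qweight_le P_ge2 N.
by move: IH; set a := \sum_(_ < _) _; set b := qweight _ _; set c := _ ^+ N; lra.
Qed.

Lemma is_cvg_qweight_series : cvgn (series (qweight P)).
Proof.
apply: nondecreasing_is_cvgn.
  by apply: nondecreasing_series => i _ _; rewrite ltW ?qweight_gt0.
exists (9 / 2) => _ [N _ <-]; rewrite /series /= big_mkord; exact: qweight_sum_le.
Qed.

Lemma is_cvg_qweight_alt i : cvgn (series (fun j => (- x ^+ i) ^+ j * qweight P j)).
Proof.
apply: normed_cvg; apply: (series_le_cvg _ _ _ is_cvg_qweight_series) => j /=.
- by [].
- by rewrite ltW ?qweight_gt0.
rewrite normrM (ger0_norm (ltW (qweight_gt0 P_ge2 j))) ler_piMl //.
  by rewrite ltW ?qweight_gt0.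
rewrite normrX normrN exprn_ile1 // ger0_norm ?exprn_ge0 ?(ltW x_gt0) //.
by rewrite exprn_ile1 // ltW.
Qed.

(* Euler's series sum_j z^j / ((1-x)...(1-x^j)) at z = - x^(i+1), x = 1 / P. *)
Definition qalt (i : nat) : R := limn (series (fun j => (- x ^+ i) ^+ j * qweight P j)).

Let qaltE i : \sum_(j < n) (- x ^+ i) ^+ j * qweight P j @[n --> \oo] --> qalt i.
Proof.
have := @is_cvg_qweight_alt i; rewrite /qalt.
have -> : series (fun j => (- x ^+ i) ^+ j * qweight P j) =
  (fun n => \sum_(j < n) (- x ^+ i) ^+ j * qweight P j).
  by apply/funext => n; rewrite /series /= big_mkord.
by move=> H.
Qed.

(** Euler's functional equation: replacing z by xz multiplies the series by 1 - z, already visible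
    on partial sums. *)
Lemma qaltS i : qalt i.+1 = (1 + x ^+ i.+1) * qalt i.
Proof.
pose S i n : R := \sum_(j < n) (- x ^+ i) ^+ j * qweight P j.
have E n : S i.+1 n.+1 = S i n.+1 + x ^+ i.+1 * S i n.
  rewrite addrC; apply/eqP; rewrite -subr_eq -opprB eqr_oppLR /S -sumrB.
  rewrite big_ord_recl /= !expr0 subrr add0r.
  apply/eqP; rewrite mulr_sumr -sumrN; apply: eq_bigr => j _.
  rewrite /bump /= add1n qweightS !Px -mulrBl.
  have a := xS_lt1 j; have b : x ^+ j != 0 by rewrite expf_neq0 // gt_eqF.
  have -> : (x ^+ j)^-1 / ((x ^+ j.+1)^-1 - 1) = x / (1 - x ^+ j.+1).
    rewrite exprS; field; rewrite b ?gt_eqF // ?mulf_neq0 // ?gt_eqF //=.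
    by rewrite subr_gt0 -exprS.
  have -> : (- x ^+ i.+1) ^+ j.+1 = (- x ^+ i) ^+ j.+1 * x ^+ j.+1.
    by rewrite -exprMn; congr (_ ^+ _); rewrite exprSr mulNr.
  rewrite -{1}[(- x ^+ i) ^+ j.+1]mulr1 -mulrBr exprS [x ^+ i.+1]exprS.
  by field; rewrite gt_eqF // subr_gt0.
have H1 : S i.+1 n.+1 @[n --> \oo] --> qalt i.+1 by move: (@qaltE i.+1); rewrite -cvg_shiftS.
have H2 : S i.+1 n.+1 @[n --> \oo] --> qalt i + x ^+ i.+1 * qalt i.
  under eq_fun do rewrite E.
  apply: cvgD; first by move: (@qaltE i); rewrite -cvg_shiftS.
  by apply: cvgMl_tmp; exact: qaltE.
by rewrite (cvg_unique _ H1 H2) // mulrDl mul1r.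
Qed.

Lemma qalt_cvg1 : qalt i @[i --> \oo] --> (1 : R).
Proof.
have B i : `|qalt i - 1| <= x ^+ i * (9 / 2).
  have H : (`|\sum_(j < n.+1) (- x ^+ i) ^+ j * qweight P j - 1|) @[n --> \oo] --> `|qalt i - 1|.
    apply: cvg_norm; apply: cvgB; last exact: cvg_cst.
    by move: (@qaltE i); rewrite -cvg_shiftS.
  apply: (ler_cvg_to H (cvg_cst _)); apply: nearW => n.
  rewrite big_ord_recl /= expr0 mul1r.
  have -> : qweight P 0 = 1 by rewrite /qweight /qfac big_ord0 divr1.
  rewrite addrC addKr; apply: le_trans (ler_norm_sum _ _ _) _.
  apply: (@le_trans _ _ (x ^+ i * \sum_(j < n) qweight P (bump 0 j))).
    rewrite mulr_sumr; apply: ler_sum => j _.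
    rewrite normrM (ger0_norm (ltW (qweight_gt0 P_ge2 _))).
    rewrite ler_wpM2r // ?(ltW (qweight_gt0 P_ge2 _)) //.
    rewrite normrX normrN ger0_norm ?exprn_ge0 ?(ltW x_gt0) // /bump /= add1n exprS.
    by rewrite ler_piMr ?exprn_ile1 ?exprn_ge0 ?(ltW x_gt0) ?exprn_ile1 // ltW.
  rewrite ler_wpM2l ?exprn_ge0 ?(ltW x_gt0) //.
  apply: le_trans (qweight_sum_le n.+1); rewrite big_ord_recl.
  by rewrite lerDr ltW ?qweight_gt0.
have X : (x ^+ i * (9 / 2)) @[i --> \oo] --> (0 : R).
  rewrite -[X in _ --> X](mul0r (9 / 2)); apply: cvgMr_tmp.
  by apply: cvg_expr; rewrite ger0_norm // ltW.
rewrite -[qalt]/(fun i => qalt i).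
suff H : (qalt i - 1) @[i --> \oo] --> (0 : R).
  have -> : qalt = (fun i => (qalt i - 1) + 1) by apply/funext => i; rewrite subrK.
  rewrite -[X in _ --> X]add0r; apply: cvgD => //; exact: cvg_cst.
apply: norm_cvg0; apply: (squeeze_cvgr _ (cvg_cst 0) X).
by apply: nearW => i; rewrite normr_ge0 B.
Qed.

(** Iterating the functional equation gives [qalt n] as a product times [qalt 0], while [qalt n]
    tends to 1. *)
Lemma qprod_plus_cvg :
  \prod_(i < n) (1 + x ^+ i.+1)^-1 @[n --> \oo] --> qalt 0.
Proof.
have E n : qalt n = \prod_(i < n) (1 + x ^+ i.+1) * qalt 0.
  elim: n => [|n IH]; first by rewrite big_ord0 mul1r.
  by rewrite big_ord_recr /= qaltS IH; ring.
have pos n : 0 < \prod_(i < n) (1 + x ^+ i.+1).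
  by apply: prodr_gt0 => i _; have := exprn_gt0 i.+1 x_gt0; lra.
have H : ((qalt n)^-1 * qalt 0) @[n --> \oo] --> qalt 0.
  rewrite -[X in _ --> X]mul1r; apply: cvgMr_tmp; rewrite -[X in _ --> X]invr1.
  by apply: cvgV; [exact: oner_neq0|exact: qalt_cvg1].
have nz : qalt 0 != 0.
  apply/eqP => z; have := qalt_cvg1.
  have -> : qalt = (fun=> 0) by apply/funext => n; rewrite E z mulr0.
  by move=> /(cvg_lim (@Rhausdorff R)); rewrite lim_cst // => /esym/eqP; rewrite oner_eq0.
apply: cvg_trans H; apply: near_eq_cvg; apply: nearW => n.
by rewrite prodfV (E n) invfM mulfVK.
Qed.

(** At [y = 0], [qsum_partial] makes each finite product the inverse of a partial sum of [qweight];
    these sums converge to some [c >= 1]. *)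
Lemma qprod_minus_cvg : exists2 c : R, c != 0 &
  \prod_(i < n) (1 - x ^+ i.+1) @[n --> \oo] --> c^-1.
Proof.
have [c Hc] : exists c : R, \sum_(j < n.+1) qweight P j @[n --> \oo] --> c.
  exists (limn (series (qweight P))); have H := is_cvg_qweight_series.
  rewrite -cvg_shiftS in H; apply: cvg_trans H; apply: near_eq_cvg.
  by apply: nearW => n; rewrite /series /= big_mkord.
have E n : \prod_(i < n) (1 - x ^+ i.+1) = (\sum_(j < n.+1) qweight P j)^-1.
  have := qsum_partial P_ge2 0 n.
  have -> : \sum_(j < n.+1) (-1) ^+ j * (\prod_(i < j) (0 - P ^+ i) / qfac P j)
    = \sum_(j < n.+1) qweight P j.
    apply: eq_bigr => j _; rewrite mulrA /qweight -prodr_scale; congr (_ / _).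
    elim: (nat_of_ord j) => [|k IH]; first by rewrite big_ord0.
    by rewrite big_ord_recr /= IH binS bin1 exprD; ring.
  move=> ->; rewrite mulrA -prodr_scale invfM invrK /qfac.
  rewrite mulrC -prodfV -big_split /=; apply: eq_bigr => i _.
  rewrite Px; have a : x ^+ i.+1 != 0 by rewrite expf_neq0 // gt_eqF.
  by field.
have c1 : 1 <= c.
  apply: (ler_cvg_to (cvg_cst _) Hc); apply: nearW => n.
  rewrite big_ord_recl /qweight /qfac big_ord0 divr1 expr0 lerDl.
  by apply: sumr_ge0 => j _; rewrite ltW // qweight_gt0.
have c0 : c != 0 by rewrite gt_eqF // (lt_le_trans ltr01).
exists c => //; under eq_fun do rewrite E; exact: cvgV.
Qed.

Lemma qlimit_value (r : nat) :
  P ^- (r * r.+1 %/ 2) * infprod r.+1 (fun i => 1 - P ^- i)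
    * infprod 1 (fun i => (1 - P ^- (2 * i))^-1) = qalt 0 / qfac P r.
Proof.
have [c c0 Hc] := qprod_minus_cvg.
pose A := \prod_(i < r) (1 - x ^+ i.+1).
have A0 n : \prod_(i < n) (1 - x ^+ i.+1) != 0.
  by rewrite gt_eqF //; apply: prodr_gt0 => i _; rewrite subr_gt0.
have xP i : P ^- i = x ^+ i by rewrite exprVn.
have split_prod (f : nat -> R) n : \prod_(1 <= i < n.+1) f i = \prod_(i < n) f i.+1.
  by rewrite big_add1 big_mkord.
have E1 : infprod r.+1 (fun i => 1 - P ^- i) = c^-1 / A.
  apply/(cvg_lim (@Rhausdorff R)); rewrite -cvg_shiftS.
  have : (\prod_(i < n) (1 - x ^+ i.+1) / A) @[n --> \oo] --> c^-1 / A by exact: cvgMr_tmp.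
  apply: cvg_trans; apply: near_eq_cvg; near=> n => /=.
  have rn : (r <= n)%N by near: n; exact: nbhs_infty_ge.
  rewrite -(split_prod (fun i => 1 - x ^+ i)) (@big_cat_nat _ _ _ r.+1) //=.
  rewrite split_prod mulrC mulKf ?A0 //; apply: eq_bigr => i _; by rewrite xP.
(* Each factor splits as 1 - x^(2i) = (1 - x^i)(1 + x^i), so both product limits enter and [c]
   appears inverted twice. *)
have E2 : infprod 1 (fun i => (1 - P ^- (2 * i))^-1) = c * qalt 0.
  apply/(cvg_lim (@Rhausdorff R)); rewrite -cvg_shiftS.
  have H : ((\prod_(i < n) (1 - x ^+ i.+1))^-1 * \prod_(i < n) (1 + x ^+ i.+1)^-1) @[n --> \oo]
     --> c^-1^-1 * qalt 0.
    by apply: cvgM; [apply: cvgV => //; rewrite invr_eq0|exact: qprod_plus_cvg].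
  rewrite invrK in H; apply: cvg_trans H; apply: near_eq_cvg; apply: nearW => n /=.
  rewrite split_prod -prodfV -big_split /=; apply: eq_bigr => i _.
  by rewrite -invfM xP mulnC exprM -subr_sqr expr1n.
rewrite E1 E2 -/x.
(* The power of [P] clears the denominators of the first [r] factors, turning [A] into [qfac P r].
   The halving is exact, the exponent being 'C(r+1, 2). *)
have -> : P ^- (r * r.+1 %/ 2) = A / qfac P r.
  suff -> : qfac P r = A * P ^+ (r * r.+1 %/ 2).
    by rewrite invfM mulrA divff ?mul1r ?A0.
  rewrite /A /qfac; have -> : (r * r.+1 %/ 2 = 'C(r.+1, 2))%N by rewrite bin2 mulnC divn2.
  elim: r {A E1} => [|r IH]; first by rewrite !big_ord0 mulr1.
  rewrite !big_ord_recr /= IH [in RHS]binS bin1 exprD.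
  by rewrite !Px; field; rewrite !expf_neq0 // gt_eqF.
have f0 : qfac P r != 0 by rewrite gt_eqF // qfac_gt0.
by field; rewrite c0 A0 f0.
Unshelve. all: by end_near.
Qed.
End QLimits.

(** Averaging [bonferroni] over the law brackets [pr n r] by finitely many moments. The truncation
    [J] is fixed first, using that [qweight] tends to 0, and only then does [n] grow. *)
Lemma cvg_of_moments (R : realType) (P : R) (pr : nat -> nat -> R) (r : nat) :
  2 <= P -> (forall n d, 0 <= pr n d) ->
  (forall k, \sum_(d < n.+1) pr n d * qinj P d k @[n --> \oo] --> P ^+ 'C(k, 2)) ->
  pr n r @[n --> \oo] --> qalt P 0 / qfac P r.
Proof.
move=> P2 pr0 Hmu.
have Pn0 i : P ^+ i != 0 by rewrite expf_neq0 // gt_eqF //; lra.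
have f0 i : 0 < qfac P i by exact: qfac_gt0.
have fn0 i : qfac P i != 0 by rewrite gt_eqF.
pose mu n k := \sum_(d < n.+1) pr n d * qinj P d k.
pose c j := P ^+ (r * j) * qfac P j * qinj P r r.
have cvg_term j : mu n (r + j)%N / c j @[n --> \oo] --> qweight P j / qfac P r.
  have -> : qweight P j / qfac P r = P ^+ 'C(r + j, 2) / c j.
    rewrite /c /qweight qinjnn.
    have -> : 'C(r + j, 2) = ('C(r, 2) + 'C(j, 2) + r * j)%N.
      elim: j => [|j IH]; first by rewrite muln0 !addn0.
      by rewrite addnS !binS !bin1 IH mulnS; lia.
    by rewrite !exprD; field; rewrite ?Pn0 ?fn0.
  by apply: cvgMr_tmp; exact: Hmu.
have bnd n J : (r <= n)%N ->
  `|pr n r - \sum_(j < J.+1) (-1) ^+ j * (mu n (r + j)%N / c j)| <= mu n (r + J.+1)%N / c J.+1.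
  move=> rn.
  have -> : pr n r = \sum_(d < n.+1) pr n d * (val d == r)%:R.
    rewrite (bigD1 (inord r)) //= inordK // eqxx mulr1 big1 ?addr0 // => d.
    rewrite -val_eqE /= inordK // => /negbTE ->; exact: mulr0.
  have -> : \sum_(j < J.+1) (-1) ^+ j * (mu n (r + j)%N / c j) =
    \sum_(d < n.+1) pr n d * \sum_(j < J.+1) (-1) ^+ j * (qinj P d (r + j) / c j).
    under eq_bigr do rewrite /mu mulr_suml mulr_sumr.
    rewrite exchange_big /=; apply: eq_bigr => d _; rewrite mulr_sumr.
    by apply: eq_bigr => j _; ring.
  rewrite -sumrB /mu mulr_suml; apply: le_trans (ler_norm_sum _ _ _) _.
  apply: ler_sum => d _; rewrite -mulrBr normrM ger0_norm // -mulrA ler_wpM2l //.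
  exact: bonferroni.
have alt : \sum_(j < n.+1) (-1) ^+ j * (qweight P j / qfac P r) @[n --> \oo]
    --> qalt P 0 / qfac P r.
  have H : \sum_(j < n.+1) (- P^-1 ^+ 0) ^+ j * qweight P j @[n --> \oo] --> qalt P 0.
    have := @is_cvg_qweight_alt R P P2 0; rewrite -cvg_shiftS /qalt; apply: cvg_trans.
    by apply: near_eq_cvg; apply: nearW => n; rewrite /series /= big_mkord.
  have H' : (\sum_(j < n.+1) (- P^-1 ^+ 0) ^+ j * qweight P j) / qfac P r @[n --> \oo]
    --> qalt P 0 / qfac P r by exact: cvgMr_tmp.
  apply: cvg_trans H'; apply: near_eq_cvg; apply: nearW => n /=.
  by rewrite mulr_suml; apply: eq_bigr => j _; rewrite expr0 -mulrA.
have w0 : qweight P j.+1 / qfac P r @[j --> \oo] --> (0 : R).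
  rewrite -[X in _ --> X](mul0r (qfac P r)^-1); apply: cvgMr_tmp.
  rewrite (@cvg_shiftS _ (qweight P)).
  have H : 3 / 2 * (2 / 3) ^+ j @[j --> \oo] --> (0 : R).
    rewrite -[X in _ --> X](mulr0 (3 / 2)); apply: cvgMl_tmp; apply: cvg_expr.
    by rewrite ger0_norm; lra.
  apply: (squeeze_cvgr _ (cvg_cst 0) H); apply: nearW => j.
  by rewrite ltW ?qweight_gt0 // qweight_le.
apply/cvgrPdist_le => e e0.
(* The four shares: the tail of the limit series, the gap between truncated sums, the limiting
   Bonferroni error, and the deviation from that limit. *)
have e4 : 0 < e / 4 by lra.
have [J [J1 J2]] : exists J,
   `|qalt P 0 / qfac P r - \sum_(j < J.+1) (-1) ^+ j * (qweight P j / qfac P r)| <= e / 4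
   /\ `|0 - qweight P J.+1 / qfac P r| <= e / 4.
  have [N _ HN] : \forall J \near \oo, `|qalt P 0 / qfac P r - \sum_(j < J.+1) (-1) ^+ j *
    (qweight P j / qfac P r)| <= e / 4 /\ `|0 - qweight P J.+1 / qfac P r| <= e / 4.
    near=> J; split; near: J.
      by move/cvgrPdist_le: alt; apply.
    by move/cvgrPdist_le: w0; apply.
  by exists N; apply: HN => /=.
have F : \sum_(j < J.+1) (-1) ^+ j * (mu n (r + j)%N / c j) @[n --> \oo]
    --> \sum_(j < J.+1) (-1) ^+ j * (qweight P j / qfac P r).
  elim: (J.+1) => [|K IH].
    rewrite big_ord0; under eq_fun do rewrite big_ord0; exact: cvg_cst.
  rewrite big_ord_recr /=; under eq_fun do rewrite big_ord_recr /=.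
  by apply: cvgD => //; apply: cvgMl_tmp.
have G := cvg_term J.+1.
near=> n.
have rn : (r <= n)%N by near: n; exact: nbhs_infty_ge.
have B := bnd n J rn.
have B1 : `|\sum_(j < J.+1) (-1) ^+ j * (qweight P j / qfac P r)
    - \sum_(j < J.+1) (-1) ^+ j * (mu n (r + j)%N / c j)| <= e / 4.
  by near: n; move/cvgrPdist_le: F; apply.
have B2 : `|qweight P J.+1 / qfac P r - mu n (r + J.+1)%N / c J.+1| <= e / 4.
  by near: n; move/cvgrPdist_le: G; apply.
move: B B1 B2 J1 J2; rewrite !ler_norml.
move: (mu n _ / _) (\sum_(_ < _) _) (\sum_(_ < _) _) (qweight _ _ / _) (qalt _ _ / _) => *.
lra.
Unshelve. all: by end_near.
Qed.

(** * Decay of the conflict sum *)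

Lemma cvg_natmul_expr (R : realType) (z : R) : 0 <= z -> z < 1 ->
  t%:R * z ^+ t @[t --> \oo] --> (0 : R).
Proof.
rewrite le_eqVlt => /orP[/eqP<- _|z0 z1].
  apply: cvg_near_cst; near=> t; rewrite expr0n.
  have -> : (t == 0)%N = false by apply/negbTE; rewrite -lt0n; near: t; exact: nbhs_infty_gt.
  by rewrite mulr0.
(* Bernoulli's inequality bounds [t%:R * y ^+ t], and the other factor [y ^+ t] provides the
   decay. *)
pose y := Num.sqrt z.
have y0 : 0 < y by rewrite sqrtr_gt0.
have y1 : y < 1 by rewrite -[X in _ < X]sqrtr1 ltr_sqrt.
have zE : z = y * y by rewrite -expr2 sqr_sqrtr // ltW.
pose h := y^-1 - 1.
have h0 : 0 < h by rewrite subr_gt0 invf_gt1.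
have B t : t%:R * z ^+ t <= h^-1 * y ^+ t.
  rewrite zE exprMn mulrA ler_wpM2r ?exprn_ge0 ?(ltW y0) //.
  have H : t%:R * h <= y ^- t.
    rewrite -exprVn (_ : y^-1 = 1 + h); last by rewrite /h; ring.
    elim: t => [|t IH]; first by rewrite mul0r expr0.
    rewrite exprS -natr1.
    have : 1 <= (1 + h) ^+ t by apply: exprn_ege1; lra.
    by move: IH h0; set a := _ ^+ t; nra.
  by rewrite -ler_pdivlMr ?exprn_gt0 // mulrC ler_pdivlMr.
have C : h^-1 * y ^+ t @[t --> \oo] --> (0 : R).
  rewrite -[X in _ --> X](mulr0 h^-1); apply: cvgMl_tmp; apply: cvg_expr.
  by rewrite ger0_norm // ltW.
apply: (squeeze_cvgr _ (cvg_cst 0) C); apply: nearW => t.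
by rewrite B mulr_ge0 // exprn_ge0 // ltW.
Unshelve. all: by end_near.
Qed.

Lemma cvg_expr_self (R : realType) (c z : R) : 0 <= c -> 0 <= z -> z < 1 ->
  (c * z ^+ t) ^+ t @[t --> \oo] --> (0 : R).
Proof.
move=> c0 z0 z1.
have H : c * z ^+ t @[t --> \oo] --> (0 : R).
  rewrite -[X in _ --> X](mulr0 c); apply: cvgMl_tmp; apply: cvg_expr.
  by rewrite ger0_norm.
have C : (1 / 2) ^+ t @[t --> \oo] --> (0 : R).
  by apply: cvg_expr; rewrite ger0_norm; lra.
apply: (squeeze_cvgr _ (cvg_cst 0) C); near=> t.
have zt : 0 <= c * z ^+ t by rewrite mulr_ge0 // exprn_ge0.
rewrite exprn_ge0 //= lerXn2r ?nnegrE //; first by lra.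
have : `|0 - c * z ^+ t| <= 1 / 2.
  by near: t; move/cvgrPdist_le: H; apply; lra.
by rewrite sub0r normrN ger0_norm.
Unshelve. all: by end_near.
Qed.

Lemma expr1D_le_expR (R : realType) (a : R) (n : nat) : 0 <= a -> (1 + a) ^+ n <= expR (n%:R * a).
Proof.
move=> a0; rewrite expRM_natl lerXn2r ?nnegrE ?expR_ge0 ?addr_ge0 //.
exact: expR_ge1Dx.
Qed.

Lemma cvg_divn (B : nat) : (0 < B)%N -> (n %/ B)%N @[n --> \oo] --> \oo.
Proof.
move=> B0; apply/cvgnyPge => A; near=> n.
rewrite leq_divRL //; near: n; exact: nbhs_infty_ge.
Unshelve. all: by end_near.
Qed.

(** The threshold [t] is [n %/ B], proportional to [n]: then [sg ^+ (t * t)] beats every exponential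
    in [n], a large [B] controls the second term, and [n%:R * sg ^+ t] tends to 0 in the third. *)
Lemma conflict_sum_cvg0 (R : realType) (X : finType) (cp : rel X) (K : nat) (sg : R) :
  reflexive cp -> symmetric cp ->
  (forall H : {set X}, {in H &, forall x y, cp x y} -> (#|H| <= K)%N) ->
  (0 < K)%N -> 0 <= sg -> sg < 1 ->
  (\sum_(w : {ffun 'I_n -> X} | conflicts cp w != finset.set0) sg ^+ #|conflicts cp w|)
    / K%:R ^+ n @[n --> \oo] --> (0 : R).
Proof.
move=> cp_refl cp_sym clique_le K0 sg0 sg1.
set m := #|X|.
have K1 : 1 <= K%:R :> R by rewrite ler1n.
have m1 : 1 <= m.+1%:R :> R by rewrite ler1n.
pose th : R := (K%:R - 1 / 2) / K%:R.
have th0 : 0 <= th by apply: divr_ge0; lra.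
have th1 : th < 1 by rewrite ltr_pdivrMr; lra.
pose Q : R := (2 * m.+1%:R) ^+ m.
(* With [B = B0.+1], the second term loses at least a factor 2 per unit of [t]. *)
have [B0 HB0] : exists B0, Q * th ^+ B0.+1 <= 1 / 2.
  have H : Q * th ^+ b @[b --> \oo] --> (0 : R).
    rewrite -[X in _ --> X](mulr0 Q); apply: cvgMl_tmp; apply: cvg_expr.
    by rewrite ger0_norm.
  move/cvgrPdist_le: H => /(_ (1 / 2)) [|N _ HN]; first by lra.
  exists N; have := HN N.+1 (leqnSn N); rewrite /= sub0r normrN ger0_norm //.
  by rewrite mulr_ge0 ?exprn_ge0 // ; lra.
pose B := B0.+1.
(* A bound in [t] alone, so that its limit can be composed with [n %/ B]; the exponential comes from
   [expr1D_le_expR]. *)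
pose g (t : nat) : R := m.+1%:R ^+ B * (m.+1%:R ^+ B * sg ^+ t) ^+ t
  + (2 ^ m)%:R * (1 / 2) ^+ t
  + (2 ^ m)%:R * (expR ((B%:R * m%:R) * (t%:R * sg ^+ t + sg ^+ t)) - 1).
have gcvg : g t @[t --> \oo] --> (0 : R).
  have -> : 0 = m.+1%:R ^+ B * 0 + (2 ^ m)%:R * 0
    + (2 ^ m)%:R * (expR ((B%:R * m%:R) * (0 + 0)) - 1) :> R.
    by rewrite [0 + 0]addr0 !mulr0 expR0 subrr !mulr0 !addr0.
  apply: cvgD; first apply: cvgD.
  - by apply: cvgMl_tmp; apply: cvg_expr_self => //; rewrite exprn_ge0.
  - by apply: cvgMl_tmp; apply: cvg_expr; rewrite ger0_norm; lra.
  - apply: cvgMl_tmp; apply: cvgB; last exact: cvg_cst.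
    apply: (@continuous_cvg _ _ _ _ _ (fun t => (B%:R * m%:R) * (t%:R * sg ^+ t + sg ^+ t)) expR).
      exact: continuous_expR.
    apply: cvgMl_tmp; apply: cvgD; first exact: cvg_natmul_expr.
    by apply: cvg_expr; rewrite ger0_norm.
have gd := cvg_comp _ _ (cvg_divn (ltn0Sn B0)) gcvg.
apply: (squeeze_cvgr _ (cvg_cst 0) gd); apply: nearW => n /=.
rewrite divr_ge0 ?exprn_ge0 // ?sumr_ge0 //=; last by move=> w _; rewrite exprn_ge0.
rewrite ler_pdivrMr ?exprn_gt0 ?ltr0n //.
set t := (n %/ B0.+1)%N.
apply: le_trans (conflict_sum_le cp_refl cp_sym clique_le K0 sg0 sg1 n t) _.
have nt : (n <= B * t.+1)%N by rewrite mulnC ltnW // ltn_ceil.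
have tn : (B * t <= n)%N by rewrite mulnC leq_trunc_div.
have Kn : 1 <= K%:R ^+ n :> R by rewrite exprn_ege1.
have sgX k : 0 <= sg ^+ k by rewrite exprn_ge0.
rewrite /g [leRHS]mulrDl [X in _ <= X + _]mulrDl; apply: lerD; first apply: lerD.
(* [m.+1] keeps the base at least 1, so that the exponent can be raised from [n] to [B * t.+1]. *)
- have h1 : m%:R ^+ n <= m.+1%:R ^+ B * (m.+1%:R ^+ B) ^+ t :> R.
    rewrite -exprS -exprM; apply: (@le_trans _ _ (m.+1%:R ^+ n)).
      by rewrite lerXn2r ?nnegrE // ler_nat.
    by rewrite ler_weXn2l.
  have h2 : m%:R ^+ n * sg ^+ (t * t) <= m.+1%:R ^+ B * (m.+1%:R ^+ B * sg ^+ t) ^+ t.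
    by rewrite [leRHS](_ : _ = m.+1%:R ^+ B * (m.+1%:R ^+ B) ^+ t * sg ^+ (t * t))
       ?ler_wpM2r // exprMn -mulrA exprM.
  by rewrite (le_trans h2) // ler_peMr // mulr_ge0 ?exprn_ge0 ?mulr_ge0 ?exprn_ge0.
- rewrite -mulrA ler_wpM2l //.
  have -> : (K%:R - 1 / 2) ^+ n = th ^+ n * K%:R ^+ n.
    by rewrite -exprMn /th mulfVK // gt_eqF // ltr0n.
  rewrite mulrAC ler_wpM2r ?exprn_ge0 //.
  apply: (@le_trans _ _ (th ^+ (B * t) * (2 * m.+1%:R) ^+ (m * t))).
    rewrite ler_wpM2r ?exprn_ge0 //; first by lra.
    by rewrite ler_wiXn2l // ltW.
  rewrite !exprM -exprMn lerXn2r ?nnegrE ?mulr_ge0 ?exprn_ge0 //; try lra.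
  by rewrite mulrC.
- rewrite -[leRHS]mulrA ler_wpM2l // [leRHS]mulrBl mul1r lerB //.
  have -> : K%:R + m%:R * sg ^+ t = (1 + m%:R * sg ^+ t / K%:R) * K%:R.
    by rewrite mulrDl mul1r mulfVK // gt_eqF // ltr0n.
  rewrite exprMn ler_wpM2r ?exprn_ge0 //.
  have a0 : 0 <= m%:R * sg ^+ t by rewrite mulr_ge0.
  apply: le_trans (expr1D_le_expR n _) _; first by rewrite divr_ge0.
  rewrite ler_expR.
  apply: (@le_trans _ _ (n%:R * (m%:R * sg ^+ t))).
    by rewrite ler_wpM2l // ler_pdivrMr ?ltr0n // ler_peMr.
  apply: (@le_trans _ _ ((B * t.+1)%:R * (m%:R * sg ^+ t))).
    by rewrite ler_wpM2r // ler_nat.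
  by rewrite natrM -natr1 le_eqVlt; apply/orP; left; apply/eqP; ring.
Qed.

(** * Convergence in the two models *)

Lemma qinj_natr (R : realType) (p d k : nat) : (1 < p)%N ->
  qinj (p%:R : R) d k = (\prod_(i < k) (p ^ d - p ^ i))%:R.
Proof.
(* For [d < k] both products contain a zero factor, so truncated subtraction causes no
   discrepancy. *)
move=> p1; have [dk|kd] := ltnP d k.
  rewrite /qinj (bigD1 (Ordinal dk)) //= subrr mul0r.
  by rewrite (bigD1 (Ordinal dk)) //= subnn mul0n.
rewrite /qinj natr_prod; apply: eq_bigr => i _; rewrite natrB ?natrX //.
by rewrite leq_exp2l // ltnW // (leq_trans (ltn_ord i)).
Qed.

(** For a prime power [P] this is the proportion of [n] by [k] matrices of rank [k]; each of its [k]
    factors tends to 1. *)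
Lemma qinj_ratio_cvg (R : realType) (P : R) (k : nat) : 2 <= P ->
  qinj P n k / P ^+ (n * k) @[n --> \oo] --> (1 : R).
Proof.
move=> P2; have P0 : P != 0 by rewrite gt_eqF //; lra.
have E n : qinj P n k / P ^+ (n * k) = \prod_(i < k) (1 - P ^+ i * P^-1 ^+ n).
  rewrite exprM -exprVn -[_ * _]mulrC /qinj -prodr_scale; apply: eq_bigr => i _.
  by rewrite mulrBr mulVf ?expf_neq0 // exprVn mulrC.
apply: (@cvg_trans _ (\prod_(i < k) (1 - P ^+ i * P^-1 ^+ n) @[n --> \oo])).
  by apply: near_eq_cvg; apply: nearW => n; rewrite E.
elim: k {E} => [|k IH].
  by apply: cvg_near_cst; apply: nearW => n; rewrite big_ord0.
have step : 1 - P ^+ k * P^-1 ^+ n @[n --> \oo] --> (1 - P ^+ k * 0 : R).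
  apply: cvgB; first exact: cvg_cst.
  apply: cvgMl_tmp; apply: cvg_expr; rewrite ger0_norm ?invr_ge0; last by lra.
  by rewrite invf_lt1; lra.
rewrite mulr0 subr0 in step.
have S : \prod_(i < k) (1 - P ^+ i * P^-1 ^+ n) * (1 - P ^+ k * P^-1 ^+ n) @[n --> \oo]
    --> (1 * 1 : R) by exact: cvgM.
rewrite mulr1 in S; apply: cvg_trans S; apply: near_eq_cvg; apply: nearW => n /=.
by rewrite big_ord_recr.
Qed.

(** Grouping the points by the value of [D] reduces to [cvg_of_moments]; both models are instances,
    with [D] the corank. *)
Lemma corank_cvg (R : realType) (P : R) (T : nat -> finType) (A : forall n, {set T n})
    (wt : forall n, T n -> R) (D : forall n, T n -> nat) (r : nat) :
  2 <= P -> (forall n x, 0 <= wt n x) -> (forall n x, (D n x <= n)%N) ->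
  (forall k, \sum_(x in A n) wt n x * qinj P (D n x) k @[n --> \oo] --> P ^+ 'C(k, 2)) ->
  \sum_(x in A n | D n x == r) wt n x @[n --> \oo] --> qalt P 0 / qfac P r.
Proof.
move=> P2 wt0 Dn H.
apply: (@cvg_of_moments R P (fun n d => \sum_(x in A n | D n x == d) wt n x)) => //.
  by move=> n d; exact: sumr_ge0.
move=> k; move: (H k); apply: cvg_trans; apply: near_eq_cvg; apply: nearW => n.
have Dord x : (D n x < n.+1)%N by rewrite ltnS.
rewrite [LHS](partition_big (fun x => Ordinal (Dord x)) xpredT) //=.
apply: eq_bigr => d _; rewrite mulr_suml; apply: eq_big => [x|x /andP[_ /eqP<-]//].
by rewrite -val_eqE.
Qed.

Section Corollary.
Variables (R : realType) (p r : nat).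
Hypothesis p_prime : prime p.
Let P : R := p%:R.

Let p_gt1 : (1 < p)%N. Proof. exact: prime_gt1. Qed.
Let P_ge2 : 2 <= P. Proof. by rewrite /P ler_nat. Qed.
Let P_neq0 : P != 0. Proof. by rewrite gt_eqF //; have := P_ge2; lra. Qed.

Let kernel_countE (k N : nat) (M : 'M['F_p]_N) : M^T = M ->
  qinj P (N - \rank M) k = (kernel_count k M)%:R.
Proof.
move=> Ms; rewrite /kernel_count card_full_kermx // qinj_natr //; congr (_%:R).
by apply: eq_bigr => i _; rewrite card_Fp.
Qed.

Lemma symmx_prob_cvg :
  symmx_prob R (fun H : 'M['F_p]_n => (\rank H + r == n)%N) @[n --> \oo]
  --> qalt P 0 / qfac P r.
Proof.
pose Sym n := [set H : 'M['F_p]_n | H^T == H]%SET.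
have memS n (H : 'M['F_p]_n) : (H \in Sym n) = (H^T == H) by rewrite inE.
have symE n (H : 'M['F_p]_n) : H \in Sym n -> H^T = H by rewrite memS => /eqP.
have S0 n : (#|Sym n|)%:R != 0 :> R.
  by rewrite pnatr_eq0 cards_eq0; apply/set0Pn; exists 0; rewrite inE trmx0.
have H := @corank_cvg R P (fun n => 'M['F_p]_n : finType) Sym
  (fun n _ => (#|Sym n|)%:R^-1) (fun n H => n - \rank H)%N r P_ge2.
have {}H : \sum_(x in Sym n | (n - \rank x == r)%N) (#|Sym n|)%:R^-1 @[n --> \oo]
    --> qalt P 0 / qfac P r.
  apply: H => [n x|n x|k]; first by rewrite invr_ge0.
    exact: leq_subr.
  have : P ^+ 'C(k, 2) * (qinj P n k / P ^+ (n * k)) @[n --> \oo] --> P ^+ 'C(k, 2) * 1.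
    by apply: cvgMl_tmp; exact: qinj_ratio_cvg.
  rewrite mulr1; apply: cvg_trans; apply: near_eq_cvg; apply: nearW => n /=.
  rewrite -mulr_sumr (eq_bigr (fun H => (kernel_count k H)%:R)) => [|H HS]; last first.
    by rewrite kernel_countE // symE.
  rewrite -natr_sum.
  have /(congr1 (fun m => m%:R : R)) := symmetric_kernel_count n k p_prime.
  rewrite !natrM !natrX -qinj_natr // -/P -/(Sym n) => e.
  rewrite [RHS]mulrC; apply: (canRL (mulfK (S0 n))).
  apply: (mulIf (expf_neq0 (n * k) P_neq0)).
  rewrite [RHS]e; field; exact: expf_neq0.
apply: cvg_trans H; apply: near_eq_cvg; apply: nearW => n.
rewrite /symmx_prob sumr_const -[LHS]mulr_natl; congr (_%:R / _).
apply: eq_card => H; rewrite !inE; congr (_ && _); first exact: memS.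
have rk := rank_leq_row H.
by apply/eqP/eqP => ?; lia.
Qed.

Lemma gnq_prob_cvg (q : R) : 0 < q -> q < 1 ->
  gnq_prob q (fun g : {set {set 'I_n}} => has_dim (tensor (sandpile g) 'F_p) r) @[n --> \oo]
  --> qalt P 0 / qfac P r.
Proof.
move=> q0 q1.
have [psi [psiD psi1 psiN]] := Fp_character R[i] p_prime.
have [sg /andP[sg0 sg1] Hsg] := edge_char_bound q0 q1 psi1 psiN.
(* A graph on [n.+1] vertices has a reduced Laplacian of size [n]. *)
rewrite -cvg_shiftS.
pose A n := powerset (pairs n.+1).
pose D n (g : {set {set 'I_n.+1}}) := (n - \rank (reduced_laplacian p g))%N.
have H := @corank_cvg R P (fun n => {set {set 'I_n.+1}} : finType) A
  (fun n g => gnq_weight q g) D r P_ge2.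
have {}H : \sum_(g in A n | D n g == r) gnq_weight q g @[n --> \oo] --> qalt P 0 / qfac P r.
  apply: H => [n g|n g|k].
  - by apply: prodr_ge0 => e _; case: ifP => _; [exact: ltW|rewrite subr_ge0 ltW].
  - exact: leq_subr.
  pose err n := \sum_(w : {ffun 'I_n.+1 -> 'rV['F_p]_k * 'rV['F_p]_k}
       | conflicts (@hyperbolic_rel _ k) w != finset.set0)
       sg ^+ #|conflicts (@hyperbolic_rel _ k) w| / P ^+ (n * k).
  have err0 : err n @[n --> \oo] --> (0 : R).
    have cl (H : {set 'rV['F_p]_k * 'rV['F_p]_k}) :
        {in H &, forall x y, hyperbolic_rel x y} -> (#|H| <= p ^ k)%N.
      by move=> /hyperbolic_clique_le; rewrite card_Fp.
    have K0 : (0 < p ^ k)%N by rewrite expn_gt0 prime_gt0.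
    pose e n := (\sum_(w : {ffun 'I_n -> 'rV['F_p]_k * 'rV['F_p]_k}
       | conflicts (@hyperbolic_rel _ k) w != finset.set0)
       sg ^+ #|conflicts (@hyperbolic_rel _ k) w|) / (p ^ k)%:R ^+ n.
    have e0 : e n @[n --> \oo] --> (0 : R).
      exact: (conflict_sum_cvg0 (@hyperbolic_rel_refl _ k) (@hyperbolic_rel_sym _ k)).
    rewrite -cvg_shiftS in e0.
    (* The maps live on [n.+1] vertices but the division is by [P ^+ (n * k)]; the root costs the
       constant factor [P ^+ k]. *)
    have Z : P ^+ k * e n.+1 @[n --> \oo] --> P ^+ k * (0 : R) by exact: cvgMl_tmp.
    rewrite mulr0 in Z.
    apply: cvg_trans Z; apply: near_eq_cvg; apply: nearW => n /=.
    rewrite /e natrX -exprM mulnC mulSn exprD /err -mulr_suml -/P mulnC.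
    by field; rewrite !expf_neq0.
  have main : P ^+ 'C(k, 2) * (qinj P n k / P ^+ (n * k)) @[n --> \oo] --> P ^+ 'C(k, 2).
    rewrite -[X in _ --> X]mulr1; apply: cvgMl_tmp; exact: qinj_ratio_cvg.
  pose mom n := \sum_(g in A n) gnq_weight q g * qinj P (D n g) k.
  pose mn n := P ^+ 'C(k, 2) * (qinj P n k / P ^+ (n * k)).
  have bnd n : `|mom n - mn n| <= err n.
    have P0 : 0 < P ^+ (n * k) by rewrite exprn_gt0 //; have := P_ge2; lra.
    have sgb : 0 <= sg <= 1 by rewrite sg0 ltW.
    have B := gnq_moment_bound p_prime psiD psi1 n k sgb Hsg.
    rewrite /err -mulr_suml ler_pdivlMr //.
    rewrite -[X in _ * X](gtr0_norm P0) -normrM.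
    apply: le_trans B; rewrite le_eqVlt; apply/orP; left; apply/eqP; congr (`| _ |).
    rewrite mulrBl natrM natrX -qinj_natr // -/P; congr (_ - _); last first.
      by rewrite /mn; field; rewrite gt_eqF.
    rewrite /mom mulr_suml; apply: eq_bigr => g _.
    by rewrite /D kernel_countE ?reduced_laplacian_tr.
  have d0 : mom n - mn n @[n --> \oo] --> (0 : R).
    apply: norm_cvg0; apply: (squeeze_cvgr _ (cvg_cst 0) err0).
    by apply: nearW => n; rewrite normr_ge0 bnd.
  have S : (mom n - mn n) + mn n @[n --> \oo] --> 0 + P ^+ 'C(k, 2) by exact: cvgD.
  rewrite add0r in S; apply: cvg_trans S; apply: near_eq_cvg; apply: nearW => n.
  by rewrite /= subrK.
apply: cvg_trans H; apply: near_eq_cvg; apply: nearW => n /=.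
rewrite /gnq_prob; apply: eq_bigl => g; congr (_ && _).
have rk := rank_leq_row (reduced_laplacian p g).
apply/eqP/asboolP => [Dr|/(has_dim_sandpile_tensor _ p_prime)]; last by rewrite /D; lia.
by apply/(has_dim_sandpile_tensor _ p_prime); move: Dr; rewrite /D; lia.
Qed.
End Corollary.

Theorem corollary9p4 (R : realType) (q : R) (p r : nat)
    (q_gt0 : 0 < q) (q_lt1 : q < 1) (p_prime : prime p) :
  let limit : R := p%:R ^- (r * r.+1 %/ 2)
    * infprod r.+1 (fun i => 1 - p%:R ^- i)
    * infprod 1 (fun i => (1 - p%:R ^- (2 * i))^-1) in
  (gnq_prob q (fun g : {set {set 'I_n}} =>
     has_dim (tensor (sandpile g) 'F_p) r) @[n --> \oo] --> limit)
  /\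
  (symmx_prob R (fun H : 'M['F_p]_n => (\rank H + r == n)%N) @[n --> \oo]
     --> limit).
Proof.
move=> limit.
have -> : limit = qalt p%:R 0 / qfac p%:R r.
  by rewrite /limit qlimit_value // ler_nat prime_gt1.
by split; [exact: gnq_prob_cvg|exact: symmx_prob_cvg].
Qed.
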